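(* Setting: $n$ agents on a connected, undirected weighted graph $\mathcal G$ with symmetric adjacency weights $a_{i,j}$ ($a_{i,j}>0$ iff $\{i,j\}$ is an edge, else $0$) and Laplacian $L_n$; $L=L_n\otimes I_m$. For each $i$, $\Omega_i\subset\mathbb R^{q_i}$ is closed and convex, $f^i$ is strictly convex on an open set containing $\Omega_i$, $W_i\in\mathbb R^{m\times q_i}$, $d_i\in\mathbb R^m$ with $\sum_id_i=d_0$; $\Omega=\prod_i\Omega_i$, $f(x)=\sum_if^i(x_i)$, $W=[W_1,\dots,W_n]$; and Slater's condition holds (some $x$ in the interior of $\Omega$ has $Wx=d_0$). Consider the problem $\min f(x)$ s.t. $\sum_iW_ix_i=d_0$, $x_i\in\Omega_i$, and the algorithm (for $i=1,\dots,n$, $t\ge0$, arbitrary initial $y_i(0)\in\mathbb R^{q_i}$, $\lambda_i(0),z_i(0)\in\mathbb R^m$) $$\dot y_i\in\{-y_i+x_i-g_i+W_i^{\rm T}\lambda_i:\ g_i\in\partial f^i(x_i)\},$$ $$\dot\lambda_i=d_i-W_ix_i-\sum_{j}a_{i,j}(\lambda_i-\lambda_j)-\sum_ja_{i,j}(z_i-z_j),\qquad \dot z_i=\sum_ja_{i,j}(\lambda_i-\lambda_j),\qquad x_i=P_{\Omega_i}(y_i).$$ Then (i) every solution $(y(t),x(t),\lambda(t),z(t))$ is bounded; (ii) for every solution, $x(t)=[x_1(t)^{\rm T},\dots,x_n(t)^{\rm T}]^{\rm T}$ converges to the optimal solution of the problem as $t\to\infty$.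
   Context: $\partial f^i$ is the convex subdifferential; $P_{\Omega_i}$ is Euclidean projection onto $\Omega_i$. A solution is an absolutely continuous function on $[0,\infty)$ satisfying the inclusion/equations for almost all $t$ (solutions are assumed to exist on $[0,\infty)$).
   Formalization: The formal theorem additionally assumes that the problem has an optimal solution; without it the claim fails (n=1, Ω=ℝ, f(x)=e^x, W=0, d=0 gives an unbounded solution and no optimum). *)

(* Defs.v *)
From HB Require Import structures.
From mathcomp Require Import all_boot all_order all_algebra.
From mathcomp Require Import all_classical all_reals all_analysis.
Set Implicit Arguments. Unset Strict Implicit. Unset Printing Implicit Defensive.
Import Order.TTheory GRing.Theory Num.Theory.
Import numFieldNormedType.Exports.
Local Open Scope classical_set_scope.
Local Open Scope ring_scope.

Section Defs.
Variable R : realType.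

Definition vdot (k : nat) (u v : 'cV[R]_k) : R := (u^T *m v) 0 0.
Definition sqnorm (k : nat) (u : 'cV[R]_k) : R := vdot u u.

Definition strictly_convex_on (k : nat) (U : set 'cV[R]_k) (f : 'cV[R]_k -> R)
  : Prop :=
  forall u v, U u -> U v -> u != v -> forall l : R, 0 < l -> l < 1 ->
    f (l *: u + (1 - l) *: v) < l * f u + (1 - l) * f v.

(* convex subdifferential of f (defined on the open convex set U) at u *)
Definition subdiff (k : nat) (U : set 'cV[R]_k) (f : 'cV[R]_k -> R)
  (u : 'cV[R]_k) : set 'cV[R]_k :=
  [set g | forall w, U w -> f u + vdot g (w - u) <= f w].

Definition is_proj (k : nat) (S : set 'cV[R]_k) (y p : 'cV[R]_k) : Prop :=
  S p /\ forall w, S w -> sqnorm (y - p) <= sqnorm (y - w).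

(* absolute continuity of a real function on [a, b]: finite families of
   non-overlapping subintervals, listed in increasing order *)
Definition abs_cont (a b : R) (f : R -> R) : Prop :=
  forall e : R, 0 < e -> exists2 d : R, 0 < d &
    forall s : seq (R * R),
      all (fun p => (a <= p.1) && (p.1 <= p.2) && (p.2 <= b)) s ->
      sorted (fun p q => p.2 <= q.1) s ->
      \sum_(p <- s) (p.2 - p.1) < d ->
      \sum_(p <- s) `|f p.2 - f p.1| < e.

Definition loc_abs_cont (k l : nat) (F : R -> 'M[R]_(k, l)) : Prop :=
  forall T : R, 0 < T -> forall (a : 'I_k) (b : 'I_l),
    abs_cont 0 T (fun t => F t a b).

Definition has_deriv (k l : nat) (F : R -> 'M[R]_(k, l)) (t : R)
  (D : 'M[R]_(k, l)) : Prop :=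
  forall (a : 'I_k) (b : 'I_l), is_derive t 1 (fun s => F s a b) (D a b).

End Defs.

(* Main.v *)
Require Import Defs.
From HB Require Import structures.
From mathcomp Require Import all_boot all_order all_algebra.
From mathcomp Require Import all_classical all_reals all_analysis.
From mathcomp Require Import ring lra.
Set Implicit Arguments. Unset Strict Implicit. Unset Printing Implicit Defensive.
Import Order.TTheory GRing.Theory Num.Theory.
Import numFieldNormedType.Exports.
Local Open Scope classical_set_scope.
Local Open Scope ring_scope.

(* With [P] the projection onto Omega_i, [(|y - x*|^2 - |y - P y|^2) / 2] is
   differentiable in [y] with gradient [P y - x*] and is at least
   [|P y - x*|^2 / 2].  Let [V] be the sum of these functions and of
   [|lambda_i - l0|^2 / 2] and [|z_i - z*_i|^2 / 2], where [l0] is a Lagrange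
   multiplier (it exists by Slater's condition) and [L z* = d - W x*] (solvable
   because the graph is connected).  Along a solution,
   [V' <= - sum_i gap_i(x_i) - <lambda, L lambda>], where
   [gap_i(w) = f_i(w) - f_i(x*_i) - <l0, W_i (w - x*_i)>] is nonnegative on
   Omega_i and vanishes only at [x*_i] by strict convexity.  So [V] decreases,
   which bounds [x], [lambda], [z]; subgradients are bounded on the compact set
   where [x] lives, and [y' = - y + bounded] then bounds [y] and makes [x]
   Lipschitz in time.  If [x_i] were far from [x*_i] at arbitrarily large times,
   it would stay so for a fixed duration, and each time [V] would drop by a
   fixed amount, which is impossible since [V >= 0]. *)

(** * Absolute continuity *)

Section AbsoluteContinuity.
Variable R : realType.
Implicit Types (F G : R -> R) (a b c t T : R).

(** Caratheodory's slope function gives the estimate on both sides of [t] at once, the form needed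
    to add up increments across [t]. *)
Lemma is_derive_epsP F t l : is_derive t 1 F l <->
  forall e, 0 < e -> exists2 d, 0 < d &
    forall s, `|s - t| < d -> `|F s - F t - l * (s - t)| <= e * `|s - t|.
Proof.
split.
  move=> /is_derive1_caratheodory[g [Fg gc <-]] e e0.
  have /cvgrPdist_lt/(_ _ e0) := gc.
  move=> /nbhs_ballP[d /= d0 dP]; exists d => // s std.
  rewrite Fg -mulrBl normrM ler_wpM2r//.
  by rewrite distrC ltW//; apply: dP; rewrite /ball/= distrC.
move=> H; apply/is_derive1_caratheodory.
exists (fun s => if s == t then l else (F s - F t) / (s - t)); split; last first.
- by rewrite eqxx.
- apply/cvgrPdist_le => e e0; rewrite eqxx.
  have [d d0 dP] := H _ e0; apply/nbhs_ballP; exists d => //= s.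
  rewrite /ball/= distrC => std; have [_|st] := eqVneq s t.
    by rewrite subrr normr0 ltW.
  have st0 : s - t != 0 by rewrite subr_eq0.
  rewrite distrC -(ler_pM2r (_ : 0 < `|s - t|)) ?normr_gt0// -normrM.
  by rewrite mulrBl divfK//; exact: dP.
- move=> z; have [->|zt] := eqVneq z t; first by rewrite !subrr mulr0.
  by rewrite divfK// subr_eq0.
Qed.

(** Real induction. At [sup S] the step carries [P] from a point of [S] just below to
    [min b (sup S + d / 2)], which would exceed the supremum unless it is [b]. *)
Lemma segment_ind (P : R -> Prop) a b : a <= b -> P a ->
  (forall t, a <= t <= b -> exists2 d, 0 < d &
     forall u v, a <= u -> u <= t -> t <= v -> v <= b ->
       t - d < u -> v < t + d -> P u -> P v) ->
  P b.
Proof.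
move=> ab Pa step; pose S := [set s | a <= s <= b /\ P s].
have Sa : S a by split => //; rewrite lexx.
have supS : has_sup S by split; [exists a | exists b => s [/andP[]]].
have aS : a <= sup S by apply: ub_le_sup => //; case: supS.
have Sb : sup S <= b by apply: ge_sup; [exists a | move=> s [/andP[]]].
have [d d0 dP] := step (sup S) (introT andP (conj aS Sb)).
have [u [/andP[au ub] Pu] du] := sup_adherent d0 supS.
have uS : u <= sup S.
  by apply: ub_le_sup; [case: supS | split => //; rewrite au ub].
pose v := Num.min b (sup S + d / 2).
have Sv : sup S <= v by rewrite le_min Sb/=; lra.
have vb : v <= b by rewrite ge_min lexx.
have vd : v < sup S + d.
  have : v <= sup S + d / 2 by rewrite ge_min lexx orbT.
  lra.
have Pv : P v by apply: (dP u).
have vS : v <= sup S.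
  by apply: ub_le_sup; [case: supS | split => //; rewrite vb andbT; lra].
move: vS Pv; rewrite /v; case: (leP b (sup S + d / 2)) => // _ h _; exfalso.
lra.
Qed.

Lemma abs_cont_sub a b a' b' F : a <= a' -> b' <= b ->
  abs_cont a b F -> abs_cont a' b' F.
Proof.
move=> aa bb Fac e e0; have [d d0 dP] := Fac _ e0; exists d => // s sab.
apply: dP; apply: sub_all sab => p /andP[/andP[p1 ->] p2].
by rewrite (le_trans aa p1) (le_trans p2 bb).
Qed.

Lemma abs_cont_local a b F e : 0 < e -> abs_cont a b F -> exists2 d, 0 < d &
  forall u v, a <= u -> u <= v -> v <= b -> v - u < d -> `|F v - F u| < e.
Proof.
move=> e0 /(_ _ e0)[d d0 dP]; exists d => // u v au uv vb vud.
by have := dP [:: (u, v)]; rewrite !big_seq1/= au uv vb; apply.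
Qed.

Lemma abs_cont_bounded a b F : abs_cont a b F ->
  exists2 B, 0 <= B & forall t, a <= t <= b -> `|F t| <= B.
Proof.
move=> Fac; have [ab|ba] := leP a b; last first.
  by exists 0 => // t /andP[h1 h2]; exfalso; lra.
have [d d0 dP] := abs_cont_local ltr01 Fac.
suff : exists2 B, 0 <= B & forall t, a <= t <= b -> t <= b -> `|F t| <= B.
  by move=> [B B0 h]; exists B => // t /[dup] tab /andP[_ tb]; exact: h.
apply: (@segment_ind
  (fun s => exists2 B, 0 <= B & forall t, a <= t <= b -> t <= s -> `|F t| <= B)
  a b) => //.
  exists `|F a| => // t /andP[h1 _] h2.
  by have -> : t = a by apply/eqP; rewrite eq_le h1 h2.
move=> t tab; exists (d / 2); first lra.
move=> u v au ut tv vb tu vt [B B0 hB]; exists (B + 1); first lra.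
move=> s sab sv; have [su|us] := leP s u.
  by apply: le_trans (hB _ sab su) _; lra.
have h : `|F s - F u| < 1 by apply: dP; move: sab => /andP[? ?]; lra.
have : `|F u| <= B by apply: hB; [apply/andP; split; lra | lra].
rewrite -[F s](subrK (F u)) => ?; apply: le_trans (ler_normD _ _) _; lra.
Qed.

(** The common source of absolute continuity below: sums, Lipschitz images and products have
    increments dominated by those of finitely many absolutely continuous functions. *)
Lemma abs_cont_dom (I : finType) (g : I -> R -> R) a b F C :
  (forall i, abs_cont a b (g i)) ->
  (forall u v, a <= u -> u <= v -> v <= b ->
     `|F v - F u| <= C * \sum_i `|g i v - g i u|) ->
  abs_cont a b F.
Proof.
move=> gac FC e e0; pose C' := `|C| + 1.
have C'0 : 0 < C' by rewrite /C' ltr_wpDl.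
pose e' := e / (C' * (#|I|%:R + 1)).
have D0 : 0 < C' * (#|I|%:R + 1) by rewrite mulr_gt0// ltr_wpDl.
have e'0 : 0 < e' by rewrite divr_gt0.
pose d i := xget 1 [set d | 0 < d /\ forall s : seq (R * R),
      all (fun p => (a <= p.1) && (p.1 <= p.2) && (p.2 <= b)) s ->
      sorted (fun p q => p.2 <= q.1) s ->
      \sum_(p <- s) (p.2 - p.1) < d ->
      \sum_(p <- s) `|g i p.2 - g i p.1| < e'].
have dP i := xgetPex 1 (iffLR (exists2P _ _) (gac i _ e'0)).
have d0 i : 0 < d i by have [] := dP i.
exists (\big[Num.min/1]_i d i).
  exact: lt_bigmin.
move=> s sab ss sd.
have h i : \sum_(p <- s) `|g i p.2 - g i p.1| <= e'.
  apply/ltW; have [_] := dP i; apply => //.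
  by apply: lt_le_trans sd _; exact: bigmin_le_cond.
apply: (@le_lt_trans _ _ (C' * \sum_i \sum_(p <- s) `|g i p.2 - g i p.1|)).
  rewrite exchange_big mulr_sumr; elim: s sab {ss sd h} => [|p s IH] /=.
    by rewrite !big_nil.
  move=> /andP[/andP[/andP[p1 p12] p2] sab]; rewrite !big_cons lerD ?IH//.
  apply: le_trans (FC _ _ p1 p12 p2) _; rewrite ler_wpM2r ?sumr_ge0//.
  by rewrite (le_trans (ler_norm _))// lerDl.
apply: (@le_lt_trans _ _ (C' * \sum_(i : I) e')).
  by rewrite ler_pM2l//; apply: ler_sum => i _.
rewrite sumr_const -[e' *+ _]mulr_natr mulrCA /e'.
by rewrite mulrAC ltr_pdivrMr// ltr_pM2l// ltr_pM2l// ltrDl.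
Qed.

Lemma abs_cont_sum (I : finType) (g : I -> R -> R) a b :
  (forall i, abs_cont a b (g i)) -> abs_cont a b (fun t => \sum_i g i t).
Proof.
move=> gac; apply: (@abs_cont_dom _ g _ _ _ 1) => // u v _ _ _.
by rewrite mul1r -sumrB; exact: ler_norm_sum.
Qed.

Lemma abs_contD F G u v : abs_cont u v F -> abs_cont u v G ->
  abs_cont u v (F \+ G).
Proof.
move=> Fac Gac.
apply: (@abs_cont_dom _ (fun b : bool => if b then F else G) _ _ _ 1).
  by case.
move=> r s _ _ _; rewrite mul1r big_bool/= opprD addrACA; exact: ler_normD.
Qed.

(* [E] is covered by an open set of small measure.  Going from [a] to [b] by
   small steps, those around points of [E] stay in this open set, so absolute
   continuity bounds their total contribution; each other step increases [F]
   by at most [c + e] times its length. *)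
Lemma abs_cont_le a b F c (E : set R) : a <= b -> abs_cont a b F ->
  (@lebesgue_measure R).-negligible E ->
  (forall t, a <= t <= b -> ~ E t -> exists2 D, is_derive t 1 F D & D <= c) ->
  F b - F a <= c * (b - a).
Proof.
move=> ab Fac [B [mB B0 EB]] FD.
have {}B0 : lebesgue_measure B = 0%E := B0.
suff key e : 0 < e -> F b - F a <= (c + e) * (b - a) + e + (`|c| + e) * e.
  apply/ler_addgt0Pr => e e0.
  (* [K] dominates the coefficient of the error, [(b - a) + 1 + |c| + e'], because [e' <= 1]. *)
  pose K := (b - a) + 2 + `|c|.
  have K0 : 0 < K by rewrite /K; have := normr_ge0 c; lra.
  pose e' := Num.min 1 (e / K).
  have e'0 : 0 < e' by rewrite lt_min ltr01 divr_gt0.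
  have e'1 : e' <= 1 by rewrite ge_min lexx.
  have e'K : e' * K <= e by rewrite -ler_pdivlMr// ge_min lexx orbT.
  apply: le_trans (key _ e'0) _.
  have : e' * e' <= e' by rewrite ler_piMl// ltW.
  move: e'K; rewrite /K; lra.
move=> e0; have [d0 d00 d0P] := Fac _ e0; pose d := Num.min d0 e.
have dgt0 : 0 < d by rewrite lt_min d00.
have Boo : (lebesgue_measure B < +oo)%E by rewrite B0 ltry.
have [N [oN BN mN]] : exists U : set R, [/\ open U , B `<=` U &
    (lebesgue_measure (U `\` B) < d%:E)%E].
  exact: lebesgue_regularity_outer.
have mmN : measurable N by exact: measurable_realfun.open_measurable.
have {}mN : (lebesgue_measure N < d%:E)%E.
  apply: le_lt_trans mN.
  have {1}-> : N = (N `\` B) `|` B by rewrite setUC setDUK.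
  rewrite -[leRHS]adde0 -B0.
  by apply: measureU2 => //; exact: measurableD.
pose bad s := (N `&` `]a, s]%classic).
pose inc (l : seq (R * R)) s :=
  all (fun p => (a <= p.1) && (p.1 <= p.2) && (p.2 <= s)) l.
have mbad s : measurable (bad s) by apply: measurableI.
(* Invariant at [s]: [l] lists the steps taken around points of [E], their total length is at most
   the measure of [N] within []a, s]], and they account for all growth of [F] beyond slope
   [c + e]. *)
pose P s := exists l : seq (R * R), [/\ inc l s,
  sorted (fun p q => p.2 <= q.1) l,
  ((\sum_(p <- l) (p.2 - p.1))%:E <= lebesgue_measure (bad s))%E &
  F s - F a <= (c + e) * (s - a) +
     \sum_(p <- l) (`|F p.2 - F p.1| + (`|c| + e) * (p.2 - p.1))].
suff [l [linc lso lm lF]] : P b.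
  have ld : \sum_(p <- l) (p.2 - p.1) < d.
    rewrite -lte_fin; apply: le_lt_trans lm _; apply: le_lt_trans mN.
    by apply: le_measure => [||? []//]; apply: mem_set; [exact (mbad b)|].
  move: lF; rewrite big_split/= -mulr_sumr.
  have h1 : \sum_(p <- l) `|F p.2 - F p.1| < e.
    by apply: d0P => //; apply: lt_le_trans ld _; rewrite ge_min lexx.
  have h2 : (`|c| + e) * \sum_(p <- l) (p.2 - p.1) <= (`|c| + e) * e.
    rewrite ler_wpM2l ?addr_ge0 ?(ltW e0)//.
    by apply: le_trans (ltW ld) _; rewrite ge_min lexx orbT.
  lra.
apply: (@segment_ind P a b) => //.
  by exists [::]; split => //; rewrite ?big_nil// !subrr mulr0 addr0.
move=> t tab.
have inc_le l u v : u <= v -> inc l u -> inc l v.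
  by move=> uv; apply: sub_all => p /andP[-> /le_trans]; exact.
have bad_le u v : u <= v -> (lebesgue_measure (bad u) <= lebesgue_measure (bad v))%E.
  move=> uv; apply: le_measure; [exact: mem_set (mbad u)|exact: mem_set (mbad v)|].
  move=> s [Ns]; rewrite /bad /= !in_itv/= => /andP[-> su].
  by split => //; exact: le_trans su uv.
have [Et|nEt] := pselect (E t); last first.
  (* Outside [E], the expansions at [t] towards [u] and [v] give [F v - F u <= (c + e) * (v - u)],
     so [l] stays the same. *)
  have [D FDt Dc] := FD _ tab nEt.
  move/is_derive_epsP: FDt => /(_ _ e0)[r r0 rP]; exists r => //.
  move=> u v au ut tv vb tu vt [l [li ls lm lF]]; exists l.
  have uv := le_trans ut tv.
  split => //; first exact: inc_le li.
    exact: le_trans lm (bad_le _ _ uv).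
  have hu : `|F u - F t - D * (u - t)| <= e * `|u - t|.
    by apply: rP; rewrite ler0_norm; lra.
  have hv : `|F v - F t - D * (v - t)| <= e * `|v - t|.
    by apply: rP; rewrite ger0_norm; lra.
  have hDu : D * (t - u) <= c * (t - u) by rewrite ler_wpM2r//; lra.
  have hDv : D * (v - t) <= c * (v - t) by rewrite ler_wpM2r//; lra.
  move: hu hv; rewrite (ler0_norm (_ : u - t <= 0)); last lra.
  rewrite (ger0_norm (_ : 0 <= v - t)); last lra.
  by rewrite !ler_norml => /andP[hu _] /andP[_ hv]; lra.
(* Around a point of [E] the whole step lies in the open set [N], and [(u, v)] is appended to
   [l]. *)
have /nbhs_ballP[r /= r0 rO] : nbhs t N.
  by move: oN; rewrite openE; apply; apply: BN; exact: EB.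
exists r => // u v au ut tv vb tu vt [l [li ls lm lF]].
have uv := le_trans ut tv.
exists (rcons l (u, v)); split.
- rewrite /inc all_rcons /= au uv lexx/=; exact: inc_le li.
- case: l li ls {lm lF} => [//|p l] /allP/(_ _ (mem_last p l))/andP[_ pu] ls.
  by rewrite /= rcons_path pu andbT.
- have -> : bad v = bad u `|` `]u, v]%classic.
    rewrite /bad eqEsubset; split => s.
      move=> [Os]; rewrite /= !in_itv/= => /andP[as_ sv].
      have [su|us] := leP s u; [left; split => //|right].
        by rewrite as_.
      by rewrite sv.
    case=> [[Os]|]; rewrite /= !in_itv/=.
      by move=> /andP[-> su]; split => //; exact: le_trans uv.
    move=> /andP[us sv]; rewrite sv (le_lt_trans au us); split => //.
    by apply: rO; rewrite /ball/= ltr_norml; apply/andP; split; lra.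
  rewrite measureU; [|exact (mbad u)|exact: measurable_itv|]; last first.
    apply/seteqP; split => s // [[_]]; rewrite /= !in_itv/= => /andP[_ su].
    by move=> /andP[us _]; lra.
  rewrite -cats1 big_cat/= big_seq1/= EFinD; apply: leeD => //.
  rewrite lebesgue_measure_itv/= lte_fin; case: ifPn => //.
  by rewrite -leNgt lee_fin; lra.
- rewrite -cats1 big_cat/= big_seq1/=.
  (* The slope term [(c + e) * (v - u)] may be negative; the summand [(|c| + e) * (v - u)] makes up
     for it. *)
  have h1 : F v - F u <= `|F v - F u| by exact: ler_norm.
  have h2 : - `|c| * (v - u) <= c * (v - u).
    by rewrite ler_wpM2r ?subr_ge0// lerNl -normrN ler_norm.
  have h3 : 0 <= e * (v - u) by rewrite mulr_ge0 ?subr_ge0// ltW.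
  lra.
Qed.
End AbsoluteContinuity.

(** * Euclidean vectors and convex functions *)

Section Vectors.
Variable R : realType.

(** The norm of a vector is the max norm, used for compactness and limits; Euclidean lengths enter
    only through [sqnorm]. *)
Lemma mx_norm_bigmax k l (v : 'M[R]_(k, l)) :
  `|v| = \big[Num.max/0]_ij `|v ij.1 ij.2|.
Proof. exact: mx_normrE. Qed.

Lemma cV_normP k (v : 'cV[R]_k) r : 0 <= r ->
  reflect (forall i, `|v i 0| <= r) (`|v| <= r).
Proof.
move=> r0; rewrite mx_norm_bigmax.
apply: (iffP idP) => [/bigmax_leP[_ h] i|h]; first by have := h (i, 0) isT.
by apply/bigmax_leP; split => // -[i j] _ /=; rewrite ord1.
Qed.

Lemma cV_coord_le k (v : 'cV[R]_k) i : `|v i 0| <= `|v|.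
Proof. exact: (cV_normP v (normr_ge0 v) (lexx _) i). Qed.

Lemma vdotE k (u v : 'cV[R]_k) : vdot u v = \sum_i u i 0 * v i 0.
Proof. by rewrite /vdot mxE; apply: eq_bigr => i _; rewrite mxE. Qed.

Lemma vdotC k (u v : 'cV[R]_k) : vdot u v = vdot v u.
Proof. by rewrite !vdotE; apply: eq_bigr => i _; rewrite mulrC. Qed.

Lemma vdotDr k (u v w : 'cV[R]_k) : vdot u (v + w) = vdot u v + vdot u w.
Proof. by rewrite /vdot mulmxDr mxE. Qed.

Lemma vdotZr k (u v : 'cV[R]_k) c : vdot u (c *: v) = c * vdot u v.
Proof. by rewrite /vdot -scalemxAr mxE. Qed.

Lemma vdotNr k (u v : 'cV[R]_k) : vdot u (- v) = - vdot u v.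
Proof. by rewrite /vdot mulmxN mxE. Qed.

Lemma vdotBr k (u v w : 'cV[R]_k) : vdot u (v - w) = vdot u v - vdot u w.
Proof. by rewrite vdotDr vdotNr. Qed.

Lemma vdotZl k (u v : 'cV[R]_k) c : vdot (c *: u) v = c * vdot u v.
Proof. by rewrite vdotC vdotZr vdotC. Qed.

Lemma vdotBl k (u v w : 'cV[R]_k) : vdot (u - v) w = vdot u w - vdot v w.
Proof. by rewrite vdotC vdotBr !(vdotC w). Qed.

Lemma vdot0r k (u : 'cV[R]_k) : vdot u 0 = 0.
Proof. by rewrite /vdot mulmx0 mxE. Qed.

Lemma vdot_sumr (I : Type) (r : seq I) (P : pred I) k (u : 'cV[R]_k) F :
  vdot u (\sum_(i <- r | P i) F i) = \sum_(i <- r | P i) vdot u (F i).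
Proof. by rewrite /vdot mulmx_sumr summxE. Qed.

Lemma vdot_mulmx k l (A : 'M[R]_(k, l)) (u : 'cV[R]_k) (v : 'cV[R]_l) :
  vdot (A^T *m u) v = vdot u (A *m v).
Proof. by rewrite /vdot trmx_mul trmxK mulmxA. Qed.

Lemma sqnorm_ge0 k (u : 'cV[R]_k) : 0 <= sqnorm u.
Proof. by rewrite /sqnorm vdotE; apply: sumr_ge0 => i _; rewrite -expr2 sqr_ge0. Qed.

Lemma sqr_coord_le_sqnorm k (u : 'cV[R]_k) i : u i 0 ^+ 2 <= sqnorm u.
Proof.
rewrite /sqnorm vdotE (bigD1 i)//= -expr2 lerDl; apply: sumr_ge0 => j _.
by rewrite -expr2 sqr_ge0.
Qed.

Lemma sqnormB k (u v : 'cV[R]_k) :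
  sqnorm (u - v) = sqnorm u - 2 * vdot u v + sqnorm v.
Proof. by rewrite /sqnorm !(vdotBr, vdotBl) (vdotC v u); ring. Qed.

(** The inequality [s <= s ^ 2 + 1], applied to each coordinate, avoids square roots. *)
Lemma norm_le_sqnorm k (v : 'cV[R]_k) c : sqnorm v / 2 <= c -> `|v| <= 2 * c + 1.
Proof.
move=> vc; have v0 := sqnorm_ge0 v; apply/cV_normP => [|j]; first lra.
have := sqr_coord_le_sqnorm v j; rewrite -real_normK ?num_real//.
have := normr_ge0 (v j 0); nra.
Qed.

Lemma norm_mulmx_le k l (A : 'M[R]_(k, l)) (v : 'cV[R]_l) :
  `|A *m v| <= (\sum_i \sum_j `|A i j|) * `|v|.
Proof.
have A0 i : 0 <= \sum_j `|A i j| by exact: sumr_ge0.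
apply/cV_normP => [|i]; first by rewrite mulr_ge0// sumr_ge0.
rewrite mxE; apply: le_trans (ler_norm_sum _ _ _) _.
apply: (@le_trans _ _ (\sum_j `|A i j| * `|v|)).
  by apply: ler_sum => j _; rewrite normrM ler_wpM2l// cV_coord_le.
rewrite -mulr_suml ler_wpM2r// (bigD1 i)//= lerDl sumr_ge0 //.
Qed.

(** Heine-Borel for row vectors, carried over by transposition, which preserves the max norm. *)
Lemma cV_bounded_closed_compact k (A : set 'cV[R]_k) M :
  (forall v, A v -> `|v| <= M) -> closed A -> compact A.
Proof.
move=> AM Acl.
have tc m n : continuous (@trmx R m n).
  move=> u B /nbhs_ballP[e /= e0 eB]; apply/nbhs_ballP; exists e => // v [_ uv].
  by apply: eB; split => // i j; rewrite !mxE; exact: uv.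
have -> : A = [set trmx v | v in (@trmx R 1 k) @^-1` A].
  apply/seteqP; split => v; first by move=> Av; exists v^T; rewrite /= trmxK.
  by move=> [u Au <-].
apply: continuous_compact; first by apply: continuous_subspaceT; exact: tc.
apply: bounded_closed_compact; last first.
  by apply: preimage_closed => // x _; exact: tc.
exists M; split; first exact: num_real.
move=> r Mr v /= /AM vM; apply: le_trans _ (ltW Mr); apply: le_trans _ vM.
rewrite [leLHS]mx_norm_bigmax.
apply/bigmax_leP; split => // -[i j] _ /=; rewrite ord1.
by have := cV_coord_le v^T j; rewrite mxE.
Qed.

End Vectors.

(** * Local boundedness and semicontinuity of convex functions *)

Section Convexity.
Variables (R : realType) (q : nat).
Implicit Types (U : set 'cV[R]_q) (f : 'cV[R]_q -> R).

Definition convex_on U f := forall u v, U u -> U v -> forall l, 0 <= l <= 1 ->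
  f (l *: u + (1 - l) *: v) <= l * f u + (1 - l) * f v.

Lemma convex_set_comb U u v (l : R) : convex_set U -> U u -> U v ->
  0 <= l <= 1 -> U (l *: u + (1 - l) *: v).
Proof.
move=> cU Uu Uv /andP[l0 l1].
by have := cU u v (Itv01 l0 l1) (mem_set Uu) (mem_set Uv); rewrite inE.
Qed.

Lemma strictly_convexW U f : strictly_convex_on U f -> convex_on U f.
Proof.
move=> fU u v Uu Uv l /andP[l0 l1].
have [->|uv] := eqVneq u v.
  by rewrite -scalerDl -mulrDl addrC subrK scale1r mul1r.
have [->|l0'] := eqVneq l 0; first by rewrite !scale0r !subr0 !scale1r !mul0r mul1r !add0r.
have [->|l1'] := eqVneq l 1; first by rewrite !subrr !scale0r !scale1r !mul0r mul1r !addr0.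
by apply/ltW/fU => //; rewrite lt_def ?l0' ?l0// eq_sym l1' l1.
Qed.

Lemma open_norm_ball U x0 : open U -> U x0 ->
  exists2 r, 0 < r & forall h, `|h| <= r -> U (x0 + h).
Proof.
rewrite openE => oU /oU /nbhs_ballP[r /= r0 rU].
exists (r / 2); first lra.
move=> h hr; apply: rU; rewrite -ball_normE /ball_/= opprD addNKr normrN.
by apply: le_lt_trans hr _; lra.
Qed.

Lemma norm_scale_delta (t : R) (i : 'I_q) :
  `|t *: (delta_mx i 0 : 'cV[R]_q)| <= `|t|.
Proof.
apply/cV_normP => // j; rewrite !mxE normrM ler_piMr//.
by case: (_ && _); rewrite /= ?normr1// normr0.
Qed.

(** Induction on the number [k] of coordinates in which [h] may be nonzero: a displacement in
    [k + 1] coordinates is the midpoint of one in [k] coordinates and one along a single axis, where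
    convexity bounds [f] by the ends of a segment. *)
Lemma convex_bounded_above U f x0 : open U -> U x0 -> convex_on U f ->
  exists2 r, 0 < r & exists M, forall h, `|h| <= r -> U (x0 + h) /\ f (x0 + h) <= M.
Proof.
move=> oU Ux0 cf; have [r0 r00 r0U] := open_norm_ball oU Ux0.
suff H k : (k <= q)%N -> exists2 r, 0 < r & exists M, forall h : 'cV[R]_q,
    (forall j : 'I_q, (k <= j)%N -> h j 0 = 0) -> `|h| <= r -> f (x0 + h) <= M.
  have [r rgt0 [M rM]] := H q (leqnn q).
  exists (Num.min r r0); first by rewrite lt_min rgt0.
  exists M => h; rewrite le_min => /andP[hr hr0]; split; first exact: r0U.
  by apply: rM => // j; rewrite leqNgt ltn_ord.
elim: k => [_|k IH kq].
  exists 1 => //; exists (f x0) => h h0 _.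
  suff -> : h = 0 by rewrite addr0.
  by apply/matrixP => i j; rewrite ord1 h0// mxE.
have [r rgt0 [M rM]] := IH (ltnW kq).
pose e : 'cV[R]_q := delta_mx (Ordinal kq) 0.
pose A := Num.max (f (x0 + r0 *: e)) (f (x0 + (- r0) *: e)).
have UA t : `|t| <= r0 -> U (x0 + t *: e).
  by move=> tr; apply: r0U; exact: le_trans (norm_scale_delta _ _) tr.
have segA t : `|t| <= r0 -> f (x0 + t *: e) <= A.
  move=> tr; pose l := (r0 + t) / (2 * r0).
  have lE : l * (2 * r0) = r0 + t by rewrite /l divfK//; apply/lt0r_neq0; lra.
  have r20 : 0 < 2 * r0 by lra.
  have tr' : - r0 <= t <= r0 by rewrite -ler_norml.
  have l01 : 0 <= l <= 1.
    by rewrite divr_ge0 ?ler_pdivrMr//= ?(ltW r20)//; lra.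
  have tl : t = l * r0 + (1 - l) * - r0 by rewrite -[LHS](addKr r0) -lE; ring.
  have -> : x0 + t *: e = l *: (x0 + r0 *: e) + (1 - l) *: (x0 + (- r0) *: e).
    by apply/colP => i; rewrite !mxE {1}tl; ring.
  apply: le_trans (cf _ _ _ _ _ l01) _; try by apply: UA; rewrite ?normrN ger0_norm// ltW.
  have -> : A = l * A + (1 - l) * A by ring.
  by move: l01 => /andP[l0 l1]; apply: lerD; apply: ler_wpM2l; rewrite ?subr_ge0// /A le_max lexx ?orbT.
(* The radii are halved because writing [x0 + h] as a midpoint doubles both displacements. *)
exists (Num.min (r / 2) (r0 / 2)); first by rewrite lt_min; apply/andP; split; lra.
exists (2^-1 * M + 2^-1 * A) => h h0; rewrite le_min => /andP[hr hr0].
pose t := h (Ordinal kq) 0; pose h' := h - t *: e.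
have h'le : `|h'| <= `|h|.
  apply/cV_normP => // j; rewrite !mxE eqxx andbT.
  have [->|_] := eqVneq j (Ordinal kq); first by rewrite mulr1 /t subrr normr0.
  by rewrite mulr0 subr0; exact: cV_coord_le.
have -> : x0 + h = 2^-1 *: (x0 + 2 *: h') + (1 - 2^-1) *: (x0 + (2 * t) *: e).
  by apply/colP => i; rewrite !mxE; field.
have t2 : `|2 * t| <= r0.
  by have := cV_coord_le h (Ordinal kq); rewrite normrM ger0_norm// -/t; lra.
have h2 : `|2 *: h'| <= 2 * `|h| by rewrite normrZ ger0_norm// ler_pM2l.
apply: le_trans (cf _ _ _ _ _ _) _; [by apply: r0U; lra|exact: UA|lra|].
rewrite (_ : 1 - 2^-1 = 2^-1 :> R); last by field.
apply: lerD; rewrite ler_pM2l ?invr_gt0//; last exact: segA.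
apply: rM; last lra.
move=> j kj; rewrite !mxE eqxx andbT.
have [->|jk] := eqVneq j (Ordinal kq); first by rewrite mulr1 /t subrr mulr0.
rewrite mulr0 subr0 h0 ?mulr0// ltn_neqAle kj andbT.
by apply: contra_neq jk => kj'; apply/val_inj.
Qed.

(** [x0] is the convex combination, with weights [1 / (1 + s)] and [s / (1 + s)], of [w] and the
    opposite point [x0 + (x0 - w) / s], where [f <= M]. Hence [f w >= f x0 - s * (M - f x0)]. *)
Lemma convex_lsc U f x0 e : open U -> U x0 -> convex_on U f -> 0 < e ->
  \forall w \near x0, f x0 - e <= f w.
Proof.
move=> oU Ux0 cf e0; have [r r0 [M rM]] := convex_bounded_above oU Ux0 cf.
have fM : f x0 <= M.
  by rewrite -[x0]addr0; apply: (rM 0 _).2; rewrite normr0 ltW.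
pose s := Num.min 1 (e / (M - f x0 + 1)).
have D0 : 0 < M - f x0 + 1 by lra.
have s0 : 0 < s by rewrite lt_min ltr01 divr_gt0.
have sM : s * (M - f x0) <= e.
  apply: (@le_trans _ _ (s * (M - f x0 + 1))); first by rewrite ler_pM2l//; lra.
  by rewrite -ler_pdivlMr// ge_min lexx orbT.
apply/nbhs_ballP; exists (s * r); first by rewrite /= mulr_gt0.
move=> w; rewrite -ball_normE /ball_/= => wr.
pose l := 1 / (1 + s).
have s1 : 0 < 1 + s by lra.
have lE : l * (1 + s) = 1 by rewrite /l divfK// lt0r_neq0.
have l0 : 0 < l by rewrite divr_gt0.
have l1 : l <= 1 by rewrite /l ler_pdivrMr//; lra.
have s1r : s <= 1 by rewrite ge_min lexx.
have [Uw _] : U w /\ f w <= M.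
  rewrite -[w](subrKC x0); apply: rM; rewrite distrC; apply: le_trans (ltW wr) _.
  by rewrite ler_piMl// ltW.
have [Uv fv] : U (x0 + s^-1 *: (x0 - w)) /\ f (x0 + s^-1 *: (x0 - w)) <= M.
  apply: rM; rewrite normrZ gtr0_norm ?invr_gt0// mulrC ler_pdivrMr// mulrC.
  exact: ltW.
have h : f x0 <= l * f w + (1 - l) * f (x0 + s^-1 *: (x0 - w)).
  have {1}-> : x0 = l *: w + (1 - l) *: (x0 + s^-1 *: (x0 - w)).
    have -> : 1 - l = l * s by rewrite -{1}lE; ring.
    apply/colP => i; rewrite !mxE; move: (x0 i 0) (w i 0) => b c.
    have -> : l * c + l * s * (b + s^-1 * (b - c)) =
      l * c + l * s * b + l * (s * s^-1) * (b - c) by ring.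
    rewrite divff ?lt0r_neq0// mulr1.
    by rewrite [LHS](_ : b = (l * (1 + s)) * b); [ring|rewrite lE mul1r].
  by apply: cf; rewrite // l1 ltW.
have h2 : (1 - l) * f (x0 + s^-1 *: (x0 - w)) <= (1 - l) * M.
  by rewrite ler_wpM2l// subr_ge0.
have h3 : f x0 <= l * f w + (1 - l) * M by lra.
have h4 : (1 + s) * f x0 <= f w + s * M.
  have -> : f w + s * M = (1 + s) * (l * f w + (1 - l) * M).
    have -> : (1 + s) * (l * f w + (1 - l) * M) =
      (l * (1 + s)) * f w + ((1 + s) - (l * (1 + s))) * M by ring.
    by rewrite lE; ring.
  by rewrite ler_pM2l.
lra.
Qed.

(** Testing [g] at [w] moved by [r / 2] along an axis bounds each coordinate: [f] is at most [M]
    there and at least [f x0 - 1] at [w] by lower semicontinuity. *)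
Lemma subdiff_near_bounded U f x0 : open U -> U x0 -> convex_on U f ->
  exists C, \forall w \near x0, forall g, subdiff U f w g -> `|g| <= C.
Proof.
move=> oU Ux0 cf; have [r r0 [M rM]] := convex_bounded_above oU Ux0 cf.
exists ((M - f x0 + 1) / (r / 2)).
have hl := convex_lsc oU Ux0 cf ltr01.
near=> w => g gw.
have wl : f x0 - 1 <= f w by near: w.
have wr : `|w - x0| <= r / 2.
  rewrite distrC; apply/ltW; near: w.
  by apply/nbhs_ballP; exists (r / 2); [rewrite /=; lra|rewrite -ball_normE].
have fM : f x0 <= M.
  by rewrite -[x0]addr0; apply: (rM 0 _).2; rewrite normr0 ltW.
have r20 : 0 < r / 2 by lra.
apply/cV_normP => [|k]; first by rewrite divr_ge0 ?(ltW r20)//; lra.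
rewrite ler_pdivlMr//.
pose t := Num.sg (g k 0) * (r / 2).
have tr : `|t| <= r / 2.
  rewrite normrM (gtr0_norm r20) ler_piMl ?(ltW r20)//.
  by rewrite normr_sg; case: (_ == _).
have [Uv fv] : U (x0 + ((w - x0) + t *: delta_mx k 0)) /\
    f (x0 + ((w - x0) + t *: delta_mx k 0)) <= M.
  apply: rM; apply: le_trans (ler_normD _ _) _.
  by have := norm_scale_delta t k; lra.
rewrite addrA subrKC in Uv fv.
have := gw _ Uv; rewrite addrAC subrr add0r vdotZr.
have -> : vdot g (delta_mx k 0) = g k 0.
  rewrite vdotE (bigD1 k)//= mxE !eqxx mulr1 big1 ?addr0// => j jk.
  by rewrite mxE (negbTE jk) mulr0.
have -> : t * g k 0 = `|g k 0| * (r / 2) by rewrite /t normrEsg; ring.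
lra.
Unshelve. all: by end_near. Qed.

Lemma subdiff_bounded U f K : open U -> K `<=` U -> convex_on U f ->
  compact K -> exists C, forall w g, K w -> subdiff U f w g -> `|g| <= C.
Proof.
move=> oU KU cf /compact_near_coveringP cK.
have : \forall C \near +oo, K `<=` [set w | forall g, subdiff U f w g -> `|g| <= C].
  apply: cK => w Kw; have [C wC] := subdiff_near_bounded oU (KU _ Kw) cf.
  near=> v D; rewrite /= => g vg; apply: (@le_trans _ _ C).
    by have : forall g, subdiff U f v g -> `|g| <= C; [near: v|exact].
  by near: D; apply: nbhs_pinfty_ge; exact: num_real.
move=> /filter_ex[C h]; exists C => w g /h; exact.
Unshelve. all: by end_near. Qed.

(** By lower semicontinuity [f] stays above [f w / 2] near each [w] other than [xs], and near [xs]
    the distance condition is void; compactness then yields one [eta]. *)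
Lemma convex_pos_lower_bound U f K xs e : open U -> K `<=` U -> convex_on U f ->
  compact K -> (forall w, K w -> w != xs -> 0 < f w) -> 0 < e ->
  exists2 eta, 0 < eta & forall w, K w -> e <= `|w - xs| -> eta <= f w.
Proof.
move=> oU KU cf /compact_near_coveringP cK fpos e0.
have : \forall eta \near 0^'+,
    K `<=` [set w | e <= `|w - xs| -> eta <= f w].
  apply: cK => w Kw; have [->|wxs] := eqVneq w xs.
    near=> v D; rewrite /= leNgt => /negP[].
    rewrite distrC; near: v.
    by apply/nbhs_ballP; exists e => //; rewrite -ball_normE.
  have fw := fpos _ Kw wxs; have fw2 : 0 < f w / 2 by lra.
  have hl := convex_lsc oU (KU _ Kw) cf fw2.
  near=> v D; rewrite /= => _; apply: (@le_trans _ _ (f w - f w / 2)).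
    suff : D <= f w / 2 by lra.
    by near: D; exact: nbhs_right_le.
  by near: v.
move=> h; near (0 : R)^'+ => eta; exists eta; first by near: eta; exact: nbhs_right_gt.
by move=> w Kw; move: w Kw; near: eta.
Unshelve. all: by end_near. Qed.
End Convexity.

(** * Projections and quadratic expansions *)

Section Projection.
Variables (R : realType) (q : nat).
Implicit Types (S : set 'cV[R]_q) (y p w xs : 'cV[R]_q).

(** If the product were positive, a small step from [p] towards [w] would stay in [S] and come
    closer to [y]. *)
Lemma proj_obtuse S y p w : convex_set S -> is_proj S y p -> S w ->
  vdot (y - p) (w - p) <= 0.
Proof.
move=> cS [Sp pmin] Sw; rewrite leNgt; apply/negP => c0.
set c := vdot _ _ in c0; pose N := sqnorm (w - p).
have N0 : 0 <= N by exact: sqnorm_ge0.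
have N1 : 0 < N + 1 by lra.
(* With this [l], [l * N < c], so the quadratic term [l * l * N] cannot offset [2 * l * c]. *)
pose l := Num.min 1 (c / (N + 1)).
have l0 : 0 < l by rewrite lt_min ltr01 divr_gt0.
have l1 : l <= 1 by rewrite ge_min lexx.
have lN : l * (N + 1) <= c by rewrite -ler_pdivlMr// ge_min lexx orbT.
have l01 : 0 <= l <= 1 by rewrite ltW.
have := pmin _ (convex_set_comb cS Sw Sp l01).
have -> : y - (l *: w + (1 - l) *: p) = (y - p) - l *: (w - p).
  by apply/colP => i; rewrite !mxE; ring.
rewrite [leRHS]sqnormB vdotZr -/c [sqnorm (_ *: _)]/sqnorm vdotZl vdotZr.
rewrite -[vdot (w - p) (w - p)]/N.
move=> h; have : l * (2 * c) <= l * (l * N) by lra.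
rewrite ler_pM2l// => h2; nra.
Qed.

Lemma proj_firmly_nonexpansive S y p y' p' : convex_set S ->
  is_proj S y p -> is_proj S y' p' ->
  sqnorm (p' - p) <= vdot (p' - p) (y' - y).
Proof.
move=> cS yp yp'.
have := proj_obtuse cS yp (proj1 yp').
have := proj_obtuse cS yp' (proj1 yp).
rewrite /sqnorm !(vdotBl, vdotBr) (vdotC p' y') (vdotC p y) (vdotC p p').
rewrite (vdotC y' p) (vdotC y p'); lra.
Qed.

(** The coordinate attaining the max norm has square at most [sqnorm (p' - p)]; firm
    nonexpansiveness then lets one factor [|p' - p|] cancel. The right side has the shape asked by
    [abs_cont_dom]. *)
Lemma proj_lipschitz S y p y' p' : convex_set S ->
  is_proj S y p -> is_proj S y' p' ->
  `|p' - p| <= \sum_k `|y' k 0 - y k 0|.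
Proof.
move=> cS yp yp'; have := proj_firmly_nonexpansive cS yp yp'.
have [->|N0] := eqVneq `|p' - p| 0; first by rewrite sumr_ge0.
have [[i j] Ni] := mx_norm_neq0 N0; rewrite ord1 in Ni.
have {}Ni : `|p' - p| = `|(p' - p) i 0| by exact: Ni.
move=> h; rewrite -(ler_pM2l (_ : 0 < `|p' - p|)); last by rewrite lt_def N0 normr_ge0.
rewrite {1 2}Ni -normrM ger0_norm; last by rewrite -expr2 sqr_ge0.
rewrite -expr2; apply: le_trans (sqr_coord_le_sqnorm _ _) _.
apply: le_trans h _; rewrite vdotE mulr_sumr; apply: ler_sum => k _.
apply: le_trans (ler_norm _) _; rewrite normrM; apply: ler_pM => //.
  exact: cV_coord_le.
by rewrite !mxE.
Qed.

(* The gradient of [half_dist xs y (P y)] in [y] is [P y - xs]. *)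
Definition half_dist xs y p : R := (sqnorm (y - xs) - sqnorm (y - p)) / 2.

Lemma half_dist_ge S xs y p : convex_set S -> is_proj S y p -> S xs ->
  sqnorm (p - xs) / 2 <= half_dist xs y p.
Proof.
move=> cS yp Sxs; have := proj_obtuse cS yp Sxs.
rewrite /half_dist /sqnorm !(vdotBl, vdotBr) (vdotC p y) (vdotC xs y) (vdotC xs p).
lra.
Qed.

(** Testing the minimality of each projection against the other puts the error between 0 and
    [vdot (p' - p) (y' - y)], which firm nonexpansiveness bounds by [sqnorm (y' - y)]. *)
Lemma half_dist_expansion S xs y p y' p' : convex_set S ->
  is_proj S y p -> is_proj S y' p' ->
  `|half_dist xs y' p' - half_dist xs y p - vdot (p - xs) (y' - y)|
    <= sqnorm (y' - y).
Proof.
move=> cS yp yp'.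
have h1 := proj_firmly_nonexpansive cS yp yp'.
have h2 := proj2 yp _ (proj1 yp').
have h3 := proj2 yp' _ (proj1 yp).
have h4 := sqnorm_ge0 ((p' - p) - (y' - y)).
rewrite ler_norml; move: h1 h2 h3 h4 (sqnorm_ge0 (y' - y)).
rewrite /half_dist [sqnorm ((p' - p) - _)]sqnormB.
rewrite /sqnorm !(vdotBl, vdotBr) (vdotC p' y') (vdotC p y) (vdotC p p').
rewrite (vdotC xs y) (vdotC xs y') (vdotC p' y) (vdotC p y') (vdotC y y').
by move=> h1 h2 h3 h4 h5; apply/andP; split; lra.
Qed.

End Projection.

Lemma cV_abs_cont_bounded (R : realType) k (G : R -> 'cV[R]_k) (c : 'cV[R]_k) T :
  (forall j, abs_cont 0 T (fun t => G t j 0)) ->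
  exists B, forall t, 0 <= t <= T -> `|G t - c| <= B.
Proof.
move=> Gac; have bd j := cid2 (abs_cont_bounded (Gac j)).
have s0 : 0 <= \sum_j s2val (bd j).
  by apply: sumr_ge0 => j _; case: (bd j).
exists (\sum_j s2val (bd j) + `|c|) => t tT.
apply: le_trans (ler_normB _ _) _; rewrite lerD2r.
apply/cV_normP => // j; rewrite (bigD1 j)//= ler_wpDr//.
  by apply: sumr_ge0 => i _; case: (bd i).
by case: (bd j) => ? ? h; exact: h.
Qed.

(** * Chain rule from a first-order expansion with quadratic remainder *)

Section QuadraticExpansion.
Variables (R : realType) (q : nat) (F : R -> R) (G L : R -> 'cV[R]_q).
Hypothesis expansion : forall s t, 0 <= s -> 0 <= t ->
  `|F s - F t - vdot (L t) (G s - G t)| <= sqnorm (G s - G t).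

(** [F] acts as a function of [G] with gradient [L]. Along [G] the remainder is bounded by a sum of
    squares vanishing at [t], whose derivative there is 0. *)
Lemma is_derive_expansion t D : 0 < t -> has_deriv G t D ->
  is_derive t 1 F (vdot (L t) D).
Proof.
move=> t0 GD.
have dl : is_derive t (1 : R) (\sum_(k < q) (fun s => L t k 0 * G s k 0))
    (\sum_(k < q) (L t k 0 * D k 0)).
  by apply: is_derive_sum => k; exact: (is_deriveZ (L t k 0) (GD k 0)).
have dQ : is_derive t (1 : R) (\sum_(k < q) (fun s => (G s k 0 - G t k 0) ^+ 2)) 0.
  have h k : is_derive t (1 : R) (fun s => (G s k 0 - G t k 0) ^+ 2) 0.
    have h := is_deriveX 2 (is_deriveB (GD k 0) (is_derive_cst (G t k 0) t 1)).
    by apply: is_derive_eq h _; rewrite /= fctE subrr mulr0 scale0r.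
  by apply: is_derive_eq (is_derive_sum h) _; rewrite big1.
apply/is_derive_epsP => e e0; have e20 : 0 < e / 2 by lra.
have [d1 d10 h1] := (is_derive_epsP _ _ _).1 dl _ e20.
have [d2 d20 h2] := (is_derive_epsP _ _ _).1 dQ _ e20.
(* The bound [t] on the distance keeps [s] nonnegative, where the expansion holds. *)
exists (Num.min t (Num.min d1 d2)); first by rewrite !lt_min t0 d10.
move=> s; rewrite !lt_min => /andP[st /andP[sd1 sd2]].
have s0 : 0 <= s by move: st; rewrite ltr_norml; lra.
have := h1 _ sd1; have := h2 _ sd2; have := expansion s0 (ltW t0).
rewrite !fct_sumE.
have -> : \sum_(k < q) (G t k 0 - G t k 0) ^+ 2 = 0.
  by apply: big1 => k _; rewrite subrr expr0n.
have -> : \sum_(k < q) (G s k 0 - G t k 0) ^+ 2 = sqnorm (G s - G t).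
  by rewrite /sqnorm vdotE; apply: eq_bigr => k _; rewrite !mxE expr2.
rewrite -!vdotE vdotBr !subr0 mul0r subr0.
have -> : F s - F t - vdot (L t) D * (s - t) =
  (F s - F t - (vdot (L t) (G s) - vdot (L t) (G t))) +
  (vdot (L t) (G s) - vdot (L t) (G t) - vdot (L t) D * (s - t)) by ring.
move=> a1 a2 a3; apply: le_trans (ler_normD _ _) _.
have := le_trans (ler_norm _) a2; lra.
Qed.

Lemma abs_cont_expansion T B :
  (forall k, abs_cont 0 T (fun t => G t k 0)) ->
  (forall t, 0 <= t <= T -> `|L t| <= B) ->
  abs_cont 0 T F.
Proof.
move=> Gac LB.
have [M GM] := cV_abs_cont_bounded 0 Gac.
apply: (@abs_cont_dom _ _ (fun k t => G t k 0) _ _ _ (B + 2 * M)) => //.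
move=> u v u0 uv vT; have v0 := le_trans u0 uv; have uT := le_trans uv vT.
have uI : 0 <= u <= T by rewrite u0.
have vI : 0 <= v <= T by rewrite v0.
have dk k : `|(G v - G u) k 0| <= 2 * M.
  rewrite !mxE; apply: le_trans (ler_normB _ _) _.
  have := cV_coord_le (G u) k; have := cV_coord_le (G v) k.
  by have := GM _ uI; have := GM _ vI; rewrite !subr0; lra.
rewrite -[F v - F u](subrK (vdot (L u) (G v - G u))) mulrDl addrC.
apply: le_trans (ler_normD _ _) _; apply: lerD.
  rewrite vdotE; apply: le_trans (ler_norm_sum _ _ _) _.
  rewrite mulr_sumr; apply: ler_sum => k _; rewrite normrM !mxE ler_wpM2r//.
  exact: le_trans (cV_coord_le _ _) (LB _ uI).
apply: le_trans (expansion v0 u0) _; rewrite /sqnorm vdotE mulr_sumr.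
apply: ler_sum => k _; apply: le_trans (ler_norm _) _.
rewrite normrM; apply: ler_pM => //; by rewrite !mxE.
Qed.

End QuadraticExpansion.

Section HalfSquaredNorm.
Variable R : realType.

Lemma half_sqnorm_expansion k (c u v : 'cV[R]_k) :
  `|sqnorm (u - c) / 2 - sqnorm (v - c) / 2 - vdot (v - c) (u - v)|
    <= sqnorm (u - v).
Proof.
have -> : sqnorm (u - c) / 2 - sqnorm (v - c) / 2 - vdot (v - c) (u - v) =
    sqnorm (u - v) / 2.
  rewrite /sqnorm !(vdotBl, vdotBr) (vdotC c u) (vdotC c v) (vdotC v u); by field.
have h := sqnorm_ge0 (u - v); rewrite ger0_norm; lra.
Qed.

Lemma abs_cont_half_sqnorm k (G : R -> 'cV[R]_k) c T :
  loc_abs_cont G -> 0 < T -> abs_cont 0 T (fun t => sqnorm (G t - c) / 2).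
Proof.
move=> Gac T0; have Gk j : abs_cont 0 T (fun t => G t j 0) by exact: Gac.
have [B GB] := cV_abs_cont_bounded c Gk.
apply: (@abs_cont_expansion _ _ _ G (fun t => G t - c)) GB => // s t _ _.
exact: half_sqnorm_expansion.
Qed.

Lemma is_derive_half_sqnorm k (G : R -> 'cV[R]_k) c t D :
  0 < t -> has_deriv G t D ->
  is_derive t 1 (fun t => sqnorm (G t - c) / 2) (vdot (G t - c) D).
Proof.
move=> t0 GD; apply: (@is_derive_expansion _ _ _ G (fun t => G t - c)) => //.
by move=> s r _ _; exact: half_sqnorm_expansion.
Qed.

End HalfSquaredNorm.

(** * Lagrange multipliers under Slater's condition *)

Section Multipliers.
Variables (R : realType) (E : Type) (comb : R -> E -> E -> E).

(** Points will be families of vectors of different sizes, so [E] carries only an operation [comb].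
    Here [l] is not confined to [[0, 1]], because [comb (- e) u xs] prolongs the segment from [u]
    beyond [xs]. *)
Definition affine_fun (r : E -> R) :=
  forall l u v, r (comb l u v) = l * r u + (1 - l) * r v.

(** [c] must lie above every slope [G v / r v] with [r v < 0] and below every slope [G u / r u] with
    [r u > 0]. This is possible because a suitable combination of [u] and [v] has [r = 0], hence
    [G >= 0]. Prolonging past [xs] reverses the sign of [r], so the two sides are empty together. *)
Lemma single_multiplier (C : set E) (G r : E -> R) (xs : E) :
  (forall u v l, C u -> C v -> 0 <= l <= 1 -> C (comb l u v)) ->
  (forall u v l, C u -> C v -> 0 <= l <= 1 ->
     G (comb l u v) <= l * G u + (1 - l) * G v) ->
  affine_fun r -> r xs = 0 ->
  (forall u, C u -> exists2 e, 0 < e & C (comb (- e) u xs)) ->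
  (forall u, C u -> r u = 0 -> 0 <= G u) ->
  exists c, forall u, C u -> c * r u <= G u.
Proof.
move=> cC cG ra rxs core G0.
have reflectC u : C u -> exists2 v, C v & exists2 e, 0 < e & r v = - e * r u.
  move=> Cu; have [e e0 Cv] := core _ Cu; exists (comb (- e) u xs) => //.
  by exists e => //; rewrite ra rxs mulr0 addr0.
have [[x0 [Cx0 rx0]]|nopos] := pselect (exists x, C x /\ 0 < r x); last first.
  have r0 u : C u -> r u = 0.
    move=> Cu; apply/eqP; rewrite eq_le; apply/andP; split.
      by rewrite leNgt; apply/negP => ru; apply: nopos; exists u.
    rewrite leNgt; apply/negP => ru; have [v Cv [e e0 rv]] := reflectC _ Cu.
    by apply: nopos; exists v; split => //; rewrite rv; nra.
  by exists 0 => u Cu; rewrite mul0r G0// r0.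
pose S := [set G u / r u | u in [set u | C u /\ r u < 0]].
have S0 : S !=set0.
  have [v Cv [e e0 rv]] := reflectC _ Cx0; exists (G v / r v), v => //.
  by split => //; rewrite rv; nra.
have Sub u : C u -> 0 < r u -> ubound S (G u / r u).
  move=> Cu ru _ [v [Cv rv] <-].
  have D0 : 0 < r u - r v by lra.
  (* The weight for which [r (comb l v u) = 0]. *)
  pose l := r u / (r u - r v).
  have lE : l * (r u - r v) = r u by rewrite /l divfK// lt0r_neq0.
  have l01 : 0 <= l <= 1.
    apply/andP; split; first by apply: divr_ge0; exact: ltW.
    by rewrite ler_pdivrMr// mul1r; lra.
  have : 0 <= G (comb l v u).
    by apply: G0; [exact: cC|rewrite ra; lra].
  move=> /le_trans/(_ (cG _ _ _ Cv Cu l01)) h.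
  have h2 : 0 <= r u * G v - r v * G u.
    have -> : r u * G v - r v * G u =
      (l * (r u - r v)) * G v + ((r u - r v) - (l * (r u - r v))) * G u.
      by rewrite lE; ring.
    have -> : l * (r u - r v) * G v + (r u - r v - l * (r u - r v)) * G u =
      (r u - r v) * (l * G v + (1 - l) * G u) by ring.
    by rewrite mulr_ge0// ltW.
  rewrite ler_ndivrMr// mulrAC ler_pdivrMr//; lra.
have supS : has_sup S by split => //; exists (G x0 / r x0); exact: Sub.
exists (sup S) => u Cu; case: (ltrgt0P (r u)) => ru.
- by rewrite -ler_pdivlMr//; apply: ge_sup => //; exact: Sub.
- rewrite -ler_ndivrMr//; apply: ub_le_sup; first by case: supS.
  by exists u.
- by rewrite ru mulr0 G0.
Qed.

(** One constraint is moved into the objective at a time: [s] holds the constraints already priced,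
    and the points considered satisfy all the others exactly. *)
Lemma multipliers (I : finType) (C : set E) (F : E -> R) (r : I -> E -> R) (xs : E) :
  C xs ->
  (forall u v l, C u -> C v -> 0 <= l <= 1 -> C (comb l u v)) ->
  (forall u v l, C u -> C v -> 0 <= l <= 1 ->
     F (comb l u v) <= l * F u + (1 - l) * F v) ->
  (forall j, affine_fun (r j)) -> (forall j, r j xs = 0) ->
  (forall u, C u -> exists2 e, 0 < e & C (comb (- e) u xs)) ->
  (forall u, C u -> (forall j, r j u = 0) -> 0 <= F u) ->
  exists c : I -> R, forall u, C u -> \sum_j c j * r j u <= F u.
Proof.
move=> Cxs cC cF ra rxs core F0.
suff H (s : seq I) : exists c : I -> R, forall u, C u ->
    (forall j, j \notin s -> r j u = 0) -> \sum_j c j * r j u <= F u.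
  have [c cP] := H (enum I); exists c => u Cu; apply: cP => // j.
  by rewrite mem_enum.
elim: s => [|j0 s [c IH]].
  exists (fun=> 0) => u Cu ru; rewrite big1 => [|j _]; last by rewrite mul0r.
  by apply: F0 => // j; exact: ru.
pose C' : set E := [set u | C u /\ forall j, j \notin j0 :: s -> r j u = 0].
have [al alP] : exists al, forall u, C' u ->
    al * r j0 u <= F u - \sum_j c j * r j u.
  apply: (@single_multiplier C' _ (r j0) xs) => //.
  - move=> u v l [Cu ru] [Cv rv] l01; split; first exact: cC.
    by move=> j js; rewrite ra ru// rv// !mulr0 addr0.
  - move=> u v l [Cu _] [Cv _] l01.
    have -> : \sum_j c j * r j (comb l u v) =
      l * (\sum_j c j * r j u) + (1 - l) * (\sum_j c j * r j v).
      rewrite !mulr_sumr -big_split; apply: eq_bigr => j _ /=.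
      by rewrite ra; ring.
    by have := cF _ _ _ Cu Cv l01; lra.
  - move=> u [Cu ru]; have [e e0 Ce] := core _ Cu; exists e => //; split => //.
    by move=> j js; rewrite ra rxs ru// !mulr0 addr0.
  - move=> u [Cu ru] rj0; rewrite subr_ge0; apply: IH => // j js.
    have [->//|jj0] := eqVneq j j0.
    by apply: ru; rewrite inE negb_or jj0.
exists (fun j => c j + (if j == j0 then al else 0)) => u Cu ru.
have := alP u (conj Cu ru).
have -> : \sum_j (c j + (if j == j0 then al else 0)) * r j u =
  \sum_j c j * r j u + al * r j0 u.
  under eq_bigr do rewrite mulrDl; rewrite big_split/=; congr (_ + _).
  rewrite (bigD1 j0)//= eqxx big1 ?addr0// => j /negbTE ->.
  by rewrite mul0r.
lra.
Qed.

End Multipliers.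

(** * Graph Laplacians *)

Section Laplacian.
Variables (R : realType) (n : nat) (a : 'I_n -> 'I_n -> R).
Hypothesis a_sym : forall i j, a i j = a j i.

Definition lap m (v : 'I_n -> 'cV[R]_m) (i : 'I_n) : 'cV[R]_m :=
  \sum_j a i j *: (v i - v j).

Lemma lapB m (u v : 'I_n -> 'cV[R]_m) i :
  lap (fun k => u k - v k) i = lap u i - lap v i.
Proof.
rewrite /lap -sumrB; apply: eq_bigr => j _; rewrite -scalerBr.
by congr (_ *: _); apply/colP => k; rewrite !mxE; ring.
Qed.

(** Exchanging the names of [i] and [j] gives a second expression of the sum; the two add up to the
    symmetric form. *)
Lemma lap_bilinear m (u v : 'I_n -> 'cV[R]_m) :
  \sum_i vdot (u i) (lap v i) =
  2^-1 * \sum_i \sum_j a i j * vdot (u i - u j) (v i - v j).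
Proof.
set S := LHS.
have S1 : S = \sum_i \sum_j a i j * vdot (u i) (v i - v j).
  apply: eq_bigr => i _; rewrite vdot_sumr; apply: eq_bigr => j _.
  by rewrite vdotZr.
have S2 : S = \sum_i \sum_j a i j * vdot (u j) (v j - v i).
  rewrite S1 exchange_big; apply: eq_bigr => i _; apply: eq_bigr => j _.
  by rewrite a_sym.
have : S + S = \sum_i \sum_j a i j * vdot (u i - u j) (v i - v j).
  rewrite {1}S1 S2 -big_split; apply: eq_bigr => i _; rewrite -big_split.
  by apply: eq_bigr => j _ /=; rewrite !(vdotBl, vdotBr); ring.
by move=> <-; field.
Qed.

Lemma lap_symmetric m (u v : 'I_n -> 'cV[R]_m) :
  \sum_i vdot (u i) (lap v i) = \sum_i vdot (v i) (lap u i).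
Proof.
rewrite !lap_bilinear; congr (_ * _); apply: eq_bigr => i _.
by apply: eq_bigr => j _; rewrite vdotC.
Qed.

Hypothesis a_ge0 : forall i j, 0 <= a i j.

Lemma lap_nonneg m (u : 'I_n -> 'cV[R]_m) : 0 <= \sum_i vdot (u i) (lap u i).
Proof.
rewrite lap_bilinear mulr_ge0// ?invr_ge0//.
by apply: sumr_ge0 => i _; apply: sumr_ge0 => j _; rewrite mulr_ge0// sqnorm_ge0.
Qed.

Hypothesis a_conn : forall i j, connect (fun i j => 0 < a i j) i j.

(** The energy of [c] vanishes, so [c] agrees at the ends of each edge, and then along paths. *)
Lemma lap_kernel (c : 'I_n -> R) :
  (forall i, \sum_j a i j * (c i - c j) = 0) -> forall i j, c i = c j.
Proof.
move=> Lc; pose u i : 'cV[R]_1 := (c i)%:M.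
have : \sum_i vdot (u i) (lap u i) = 0.
  apply: big1 => i _; suff -> : lap u i = 0 by rewrite vdot0r.
  apply/colP => k; rewrite /lap summxE !mxE -[RHS](Lc i).
  by apply: eq_bigr => j _; rewrite !mxE (ord1 k) !eqxx.
rewrite lap_bilinear => /eqP; rewrite mulf_eq0 invr_eq0 pnatr_eq0/=.
rewrite psumr_eq0; last first.
  by move=> i _; apply: sumr_ge0 => j _; rewrite mulr_ge0// sqnorm_ge0.
move=> /allP h.
have edge i j : 0 < a i j -> c i = c j.
  move=> aij; have := h i (mem_index_enum i) => /=.
  rewrite psumr_eq0; last by move=> k _; rewrite mulr_ge0// sqnorm_ge0.
  move=> /allP/(_ j (mem_index_enum j))/=; rewrite mulf_eq0 (gt_eqF aij)/=.
  rewrite vdotE big_ord1 !mxE -expr2 sqrf_eq0 subr_eq0 => /eqP.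
  by rewrite !mulr1n.
move=> i j; have /connectP[p pth ->] := a_conn i j.
elim: p i pth => [//|k p IH] i /= /andP[aik pth].
by rewrite (edge _ _ aik); exact: IH.
Qed.

(* The image of the symmetric matrix of [lap] is the orthogonal of its kernel,
   which consists of the constant vectors. *)
Lemma lap_surjective m (b : 'I_n -> 'cV[R]_m) : \sum_i b i = 0 ->
  exists z : 'I_n -> 'cV[R]_m, forall i, lap z i = b i.
Proof.
move=> b0.
pose Lm : 'M[R]_n := \matrix_(i, j) ((i == j)%:R * (\sum_k a i k) - a i j).
pose B : 'M[R]_(m, n) := \matrix_(k, i) b i k 0.
have Lsum (c : 'I_n -> R) i :
    \sum_j Lm i j * c j = \sum_j a i j * (c i - c j).
  under eq_bigr do rewrite mxE mulrBl; rewrite sumrB.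
  rewrite (bigD1 i)//= eqxx mul1r [X in _ + X - _]big1 ?addr0; last first.
    by move=> j ji; rewrite eq_sym (negbTE ji) !mul0r.
  by rewrite mulr_suml -sumrB; apply: eq_bigr => j _; rewrite mulrBr.
have Lsym i j : Lm i j = Lm j i.
  rewrite !mxE a_sym eq_sym; have [->//|_] := eqVneq j i.
  by rewrite !mul0r.
(* Membership in the row space is tested against the cokernel, whose columns are constant by
   [lap_kernel]; the rows of [B] sum to zero. *)
have BL : (B <= Lm)%MS.
  rewrite submxE; apply/eqP/matrixP => k l; rewrite !mxE.
  pose c j := cokermx Lm j l.
  have cc : forall i j, c i = c j.
    apply: lap_kernel => i; rewrite -Lsum.
    by have /matrixP/(_ i l) := mulmx_coker Lm; rewrite mxE [RHS]mxE.
  have [i0 _|] := pickP (@predT 'I_n); last first.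
    by move=> h; apply: big1 => i; have := h i.
  under eq_bigr do rewrite mxE -/(c _) (cc _ i0).
  rewrite -mulr_suml; move: b0 => /colP/(_ k); rewrite summxE mxE => ->.
  by rewrite mul0r.
have /submxP[Z BZ] := BL.
exists (fun i => \col_k Z k i) => i; apply/colP => k.
rewrite /lap summxE; move: BZ => /matrixP/(_ k i); rewrite !mxE => ->.
have := Lsum (Z k) i; under eq_bigr do rewrite Lsym mulrC.
by move=> ->; apply: eq_bigr => j _; rewrite !mxE.
Qed.

End Laplacian.

(** * Differential inequalities holding almost everywhere *)

Section AlmostEverywhere.
Variable R : realType.

(** The equations are required only for [t > 0], so the point 0 joins the null set. *)
Lemma ae_derive_le (F : R -> R) u v c (P : R -> Prop) : 0 <= u -> u <= v ->
  abs_cont u v F ->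
  {ae (@lebesgue_measure R), forall t : R, 0 < t -> P t} ->
  (forall t, 0 < t -> u <= t <= v -> P t -> exists2 D, is_derive t 1 F D & D <= c) ->
  F v - F u <= c * (v - u).
Proof.
move=> u0 uv Fac aeP FD.
have N0 : (@lebesgue_measure R).-negligible [set (0 : R)].
  by apply/negligibleP; [exact: measurable_set1|exact: lebesgue_measure_set1].
apply: (abs_cont_le uv Fac (negligibleU aeP N0)) => t tuv /not_orP[nE nt0].
have t0 : 0 < t.
  by move/andP: tuv => [ut _]; rewrite lt_def (le_trans u0 ut) andbT; apply/eqP.
by apply: FD => //; exact: contrapT nE t0.
Qed.

Lemma abs_cont_id (u v : R) : abs_cont u v id.
Proof.
move=> e e0; exists e => // s sab _; apply: le_lt_trans.
rewrite big_seq [leRHS]big_seq; apply: ler_sum => p ps.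
by have /andP[/andP[_ h] _] := allP sab _ ps; rewrite ger0_norm// subr_ge0.
Qed.

(* Integrating factor: exp t * (h t - H) is nonincreasing. *)
Lemma decay_bound (h : R -> R) (H : R) (P : R -> Prop) :
  (forall T, 0 < T -> abs_cont 0 T h) ->
  {ae (@lebesgue_measure R), forall t : R, 0 < t -> P t} ->
  (forall t, 0 < t -> P t -> exists2 D, is_derive t 1 h D & D <= - h t + H) ->
  forall t, 0 <= t -> h t <= H + `|h 0 - H|.
Proof.
move=> hac aeP hD T T0; have [->|Tn0] := eqVneq T 0.
  by rewrite -lerBlDl ler_norm.
have {Tn0}T0' : 0 < T by rewrite lt_def Tn0.
pose F s := expR s * (h s - H).
have [B B0 hB] := abs_cont_bounded (hac _ T0').
have expT s : s <= T -> expR s <= expR T by rewrite ler_expR.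
(* The increments of [F] are dominated by those of [h] and of the identity, the latter controlling
   the exponential. *)
have Fac : abs_cont 0 T F.
  apply: (@abs_cont_dom _ _ (fun b : bool => if b then h else id) _ _ _
    (expR T * (1 + B + `|H|))).
    by case; [exact: hac|exact: abs_cont_id].
  move=> u v u0 uv vT; rewrite big_bool/=.
  have -> : F v - F u = expR v * (h v - h u) + (expR v - expR u) * (h u - H).
    by rewrite /F; ring.
  apply: le_trans (ler_normD _ _) _; rewrite !normrM.
  have hu : `|h u - H| <= B + `|H|.
    by apply: le_trans (ler_normB _ _) _; rewrite lerD2r hB// u0 (le_trans uv vT).
  have e1 : `|expR v| <= expR T by rewrite ger0_norm ?expR_ge0// expT.
  have e2 : `|expR v - expR u| <= expR T * `|v - u|.
    rewrite !ger0_norm ?subr_ge0 ?ler_expR//.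
    apply: (@le_trans _ _ (expR v * (v - u))); last first.
      by rewrite ler_wpM2r ?subr_ge0// expT.
    have -> : expR u = expR v * expR (u - v) by rewrite -expRD addrC subrK.
    have := expR_ge1Dx (u - v); have := expR_gt0 v; nra.
  have eT := expR_gt0 T.
  have p1 : `|expR v| * `|h v - h u| <= expR T * `|h v - h u| by rewrite ler_wpM2r.
  have p2 : `|expR v - expR u| * `|h u - H| <= (expR T * `|v - u|) * (B + `|H|).
    by rewrite ler_pM.
  have q1 : 0 <= expR T * `|v - u| by rewrite mulr_ge0// ltW.
  have q2 : 0 <= expR T * `|h v - h u| * (B + `|H|).
    by rewrite !mulr_ge0// ?(ltW eT)// addr_ge0.
  nra.
have : F T - F 0 <= 0 * (T - 0).
  apply: (ae_derive_le _ _ Fac aeP) => // t t0 tT Pt.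
  have [D hDt Dle] := hD _ t0 Pt.
  exists (expR t *: (D - 0) + (h t - H) *: expR t).
    have := is_deriveM (is_derive_expR t) (is_deriveB hDt (is_derive_cst H t 1)).
    by [].
  rewrite subr0 /GRing.scale/=; have := expR_gt0 t; nra.
rewrite mul0r subr_le0 /F expR0 mul1r => FT.
have eT : 1 <= expR T by rewrite -expR0 ler_expR.
rewrite -lerBlDl; have [hT|hT] := leP (h T - H) 0.
  exact: le_trans hT _.
apply: le_trans (ler_norm _); apply: le_trans FT.
by rewrite ler_peMl// ltW.
Qed.

End AlmostEverywhere.

(** * The Lyapunov function *)

Section Dynamics.
Variables (R : realType) (n m : nat) (q : 'I_n -> nat) (a : 'I_n -> 'I_n -> R).
Hypothesis a_sym : forall i j, a i j = a j i.
Hypothesis a_ge0 : forall i j, 0 <= a i j.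
Variable Om : forall i : 'I_n, set 'cV[R]_(q i).
Arguments Om : clear implicits.
Hypothesis Om_closed : forall i, closed (Om i).
Hypothesis Om_convex : forall i, convex_set (Om i).
Variables (f : forall i : 'I_n, 'cV[R]_(q i) -> R) (U : forall i : 'I_n, set 'cV[R]_(q i)).
Arguments f : clear implicits.
Arguments U : clear implicits.
Hypothesis U_open : forall i, open (U i).
Hypothesis OmU : forall i, Om i `<=` U i.
Hypothesis f_strict : forall i, strictly_convex_on (U i) (f i).
Variables (W : forall i : 'I_n, 'M[R]_(m, q i)) (d : 'I_n -> 'cV[R]_m).
Variable xs : forall i : 'I_n, 'cV[R]_(q i).
Hypothesis Om_xs : forall i, Om i (xs i).
Variables (l0 : 'cV[R]_m) (zs : 'I_n -> 'cV[R]_m).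

Definition gap i (w : 'cV[R]_(q i)) : R :=
  f i w - f i (xs i) - vdot l0 (W i *m (w - xs i)).

Arguments gap : clear implicits.

Hypothesis gap_ge0 : forall i w, Om i w -> 0 <= gap i w.
Hypothesis zsE : forall i, lap a zs i = d i - W i *m xs i.

Lemma gap_xs i : gap i (xs i) = 0.
Proof. by rewrite /gap !subrr mulmx0 vdot0r subr0. Qed.

(** [gap] and [f] differ by an affine function, so they have the same convexity defect. *)
Lemma gap_comb i (l : R) u v : gap i (l *: u + (1 - l) *: v) =
  f i (l *: u + (1 - l) *: v) - (l * f i u + (1 - l) * f i v) +
  (l * gap i u + (1 - l) * gap i v).
Proof.
rewrite /gap !mulmxBr mulmxDr -!scalemxAr !vdotBr vdotDr !vdotZr; ring.
Qed.

Lemma gap_convex i : convex_on (U i) (gap i).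
Proof.
move=> u v Uu Uv l l01; rewrite gap_comb.
by have := strictly_convexW (@f_strict i) Uu Uv l01; lra.
Qed.

(** At the midpoint of [w] and [xs i] the gap is nonnegative and, by strict convexity, less than
    half of [gap i w]. *)
Lemma gap_gt0 i w : Om i w -> w != xs i -> 0 < gap i w.
Proof.
move=> Ow wx; have h01 : 0 < (2^-1 : R) < 1 by lra.
have h01' : 0 <= (2^-1 : R) <= 1 by lra.
move/andP: (h01) => [h0 h1].
have := f_strict (OmU Ow) (OmU (Om_xs i)) wx h0 h1.
have := gap_ge0 (convex_set_comb (@Om_convex i) Ow (Om_xs i) h01').
rewrite gap_comb gap_xs mulr0 addr0 => ? ?.
suff : 0 < 2^-1 * gap i w by rewrite pmulr_rgt0.
lra.
Qed.

Variables (y x : forall i : 'I_n, R -> 'cV[R]_(q i)) (lam z : 'I_n -> R -> 'cV[R]_m).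
Hypothesis y_ac : forall i, loc_abs_cont (y i).
Hypothesis lam_ac : forall i, loc_abs_cont (lam i).
Hypothesis z_ac : forall i, loc_abs_cont (z i).
Hypothesis x_proj : forall i t, 0 <= t -> is_proj (Om i) (y i t) (x i t).

Definition flow t := forall i,
  (exists2 Dy : 'cV[R]_(q i), has_deriv (y i) t Dy &
     exists2 g : 'cV[R]_(q i), subdiff (U i) (f i) (x i t) g &
       Dy = - y i t + x i t - g + (W i)^T *m lam i t) /\
  has_deriv (lam i) t
    (d i - W i *m x i t - lap a (lam ^~ t) i - lap a (z ^~ t) i) /\
  has_deriv (z i) t (lap a (lam ^~ t) i).

Hypothesis ae_flow : {ae (@lebesgue_measure R), forall t : R, 0 < t -> flow t}.

Definition lyap_agent i t : R := half_dist (xs i) (y i t) (x i t) +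
  sqnorm (lam i t - l0) / 2 + sqnorm (z i t - zs i) / 2.

Definition lyap t : R := \sum_i lyap_agent i t.

Lemma x_ac i T k : 0 < T -> abs_cont 0 T (fun t => x i t k 0).
Proof.
move=> T0; apply: (@abs_cont_dom _ _ (fun j t => y i t j 0) _ _ _ 1).
  by move=> j; exact: y_ac.
move=> u v u0 uv vT; rewrite mul1r.
apply: le_trans (proj_lipschitz (@Om_convex i) (x_proj i u0) (x_proj i (le_trans u0 uv))).
by have := cV_coord_le (x i v - x i u) k; rewrite !mxE.
Qed.

Lemma lyap_ac T : 0 < T -> abs_cont 0 T lyap.
Proof.
move=> T0; apply: (abs_cont_sum (g := lyap_agent)) => i.
apply: abs_contD; last exact: abs_cont_half_sqnorm.
apply: abs_contD; last exact: abs_cont_half_sqnorm.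
have [B xB] := cV_abs_cont_bounded (xs i) (fun k => x_ac k T0).
have yk k : abs_cont 0 T (fun t => y i t k 0) by exact: y_ac.
apply: (@abs_cont_expansion _ _ _ (y i) (fun t => x i t - xs i)) xB => //.
move=> s t s0 t0.
exact: half_dist_expansion (@Om_convex i) (x_proj i t0) (x_proj i s0).
Qed.

(** The projection inequality handles [- y + x], the subgradient inequality handles [- g], and the
    terms in [W] from [y] and [lam] cancel up to the part with [l0], which completes the gap. What
    remains involves only Laplacians. *)
Lemma lyap_derive t : 0 < t -> flow t ->
  exists2 D, is_derive t 1 lyap D & D <= - \sum_i gap i (x i t).
Proof.
move=> t0 ft.
have xg i : exists g, subdiff (U i) (f i) (x i t) g /\
    has_deriv (y i) t (- y i t + x i t - g + (W i)^T *m lam i t).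
  by have [[D yD [g gU gE]] _] := ft i; exists g; rewrite -gE.
pose g i := projT1 (cid (xg i)).
have gP i : subdiff (U i) (f i) (x i t) (g i) /\
    has_deriv (y i) t (- y i t + x i t - g i + (W i)^T *m lam i t).
  exact: (projT2 (cid (xg i))).
pose Dl i := d i - W i *m x i t - lap a (lam ^~ t) i - lap a (z ^~ t) i.
pose Di i := vdot (x i t - xs i) (- y i t + x i t - g i + (W i)^T *m lam i t) +
  vdot (lam i t - l0) (Dl i) + vdot (z i t - zs i) (lap a (lam ^~ t) i).
exists (\sum_i Di i).
  have -> : lyap = \sum_i lyap_agent i.
    by apply/funext => s; rewrite fct_sumE.
  apply: is_derive_sum => i; have [_ [lD zD]] := ft i.
  apply: is_deriveD; last exact: is_derive_half_sqnorm.
  apply: is_deriveD; last exact: is_derive_half_sqnorm.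
  apply: (@is_derive_expansion _ _ _ (y i) (fun t => x i t - xs i)) => //.
    move=> s r s0 r0.
    exact: half_dist_expansion (@Om_convex i) (x_proj i r0) (x_proj i s0).
  by have [] := gP i.
(* Deviations from equilibrium: [l0] is the same for all agents, so [mu] has the Laplacian of [lam],
   while [zs] absorbs [d i - W i *m xs i]. *)
pose mu i := lam i t - l0; pose ze i := z i t - zs i.
have lap_mu i : lap a mu i = lap a (lam ^~ t) i.
  rewrite lapB [X in _ - X](_ : _ = 0) ?subr0// /lap big1// => j _.
  by rewrite subrr scaler0.
have lap_ze i : lap a ze i = lap a (z ^~ t) i - (d i - W i *m xs i).
  by rewrite lapB zsE.
have agent i : Di i <= - gap i (x i t) +
    (vdot (ze i) (lap a mu i) - vdot (mu i) (lap a mu i) - vdot (mu i) (lap a ze i)).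
  have [gU _] := gP i.
  have h1 := proj_obtuse (@Om_convex i) (x_proj i (ltW t0)) (Om_xs i).
  have h2 := gU _ (OmU (Om_xs i)).
  have h3 : Dl i = - (W i *m (x i t - xs i)) - lap a mu i - lap a ze i.
    by rewrite /Dl lap_ze lap_mu mulmxBr; apply/colP => k; rewrite !mxE; ring.
  rewrite /Di h3 -lap_mu -/(ze i) -/(mu i) /gap.
  rewrite !vdotBr vdotNr.
  have -> : vdot l0 (W i *m (x i t - xs i)) =
    vdot (lam i t) (W i *m (x i t - xs i)) - vdot (mu i) (W i *m (x i t - xs i)).
    by rewrite /mu vdotBl; ring.
  rewrite [vdot _ (_ + _)]vdotDr (vdotC (x i t - xs i) (_ *m _)) vdot_mulmx.
  move: h1 h2; set p := vdot (lam i t) _.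
  rewrite !(vdotBl, vdotBr, vdotDr, vdotNr).
  rewrite (vdotC (x i t) (y i t)) (vdotC (xs i) (y i t)) (vdotC (xs i) (x i t)).
  rewrite (vdotC (g i) (xs i)) (vdotC (g i) (x i t)).
  lra.
apply: (@le_trans _ _ (\sum_i (- gap i (x i t) +
    (vdot (ze i) (lap a mu i) - vdot (mu i) (lap a mu i) - vdot (mu i) (lap a ze i))))).
  by apply: ler_sum => i _; exact: agent.
(* The cross terms in [mu] and [ze] cancel by symmetry of the Laplacian; the term in [mu] alone is
   nonpositive. *)
rewrite big_split/= sumrN gerDl !sumrB (lap_symmetric a_sym ze).
have := lap_nonneg a_sym a_ge0 mu; lra.
Qed.

(** The gaps of the other agents are nonnegative and are discarded. With [c = 0] this is the
    monotonicity of [lyap]. *)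
Lemma lyap_drop i u v c : 0 <= u -> u <= v ->
  (forall t, u <= t <= v -> c <= gap i (x i t)) -> lyap v + c * (v - u) <= lyap u.
Proof.
move=> u0 uv cgap; have [->|uv'] := eqVneq u v; first by rewrite subrr mulr0 addr0.
have v0 : 0 < v by apply: le_lt_trans u0 _; rewrite lt_neqAle uv' uv.
have := ae_derive_le u0 uv (abs_cont_sub u0 (lexx v) (lyap_ac v0)) ae_flow.
move=> /(_ (- c)) h; have {}h : lyap v - lyap u <= - c * (v - u).
  apply: h => t t0 tuv ft; have [D LD DD] := lyap_derive t0 ft; exists D => //.
  apply: le_trans DD _; rewrite lerN2; apply: le_trans (cgap _ tuv) _.
  rewrite (bigD1 i)//= lerDl; apply: sumr_ge0 => j _; apply: gap_ge0.
  by have [] := x_proj j (ltW t0).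
lra.
Qed.

(** * Bounds on the trajectories and convergence of [x] *)

Lemma lyap_agent_ge i t : 0 <= t ->
  [/\ sqnorm (x i t - xs i) / 2 <= lyap_agent i t,
      sqnorm (lam i t - l0) / 2 <= lyap_agent i t &
      sqnorm (z i t - zs i) / 2 <= lyap_agent i t].
Proof.
move=> t0; have := half_dist_ge (@Om_convex i) (x_proj i t0) (Om_xs i).
have := sqnorm_ge0 (x i t - xs i); have := sqnorm_ge0 (lam i t - l0).
have := sqnorm_ge0 (z i t - zs i).
by rewrite /lyap_agent; split; lra.
Qed.

Lemma lyap_agent_ge0 i t : 0 <= t -> 0 <= lyap_agent i t.
Proof.
move=> t0; have [h _ _] := lyap_agent_ge i t0.
by have := sqnorm_ge0 (x i t - xs i); lra.
Qed.

Lemma lyap_ge0 t : 0 <= t -> 0 <= lyap t.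
Proof. by move=> t0; apply: sumr_ge0 => i _; exact: lyap_agent_ge0. Qed.

Lemma lyap_agent_le i t : 0 <= t -> lyap_agent i t <= lyap 0.
Proof.
move=> t0; apply: (@le_trans _ _ (lyap t)).
  by rewrite /lyap (bigD1 i)//= lerDl; apply: sumr_ge0 => j _; exact: lyap_agent_ge0.
have := @lyap_drop i 0 t 0 (lexx _) t0; rewrite mul0r addr0; apply => s /andP[s0 _].
by apply: gap_ge0; have [] := x_proj i s0.
Qed.

Let rad : R := 2 * lyap 0 + 1.

Lemma x_bounded i t : 0 <= t -> `|x i t - xs i| <= rad.
Proof.
move=> t0; have [h _ _] := lyap_agent_ge i t0; apply: norm_le_sqnorm.
exact: le_trans h (lyap_agent_le i t0).
Qed.

Lemma lam_bounded i t : 0 <= t -> `|lam i t - l0| <= rad.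
Proof.
move=> t0; have [_ h _] := lyap_agent_ge i t0; apply: norm_le_sqnorm.
exact: le_trans h (lyap_agent_le i t0).
Qed.

Lemma z_bounded i t : 0 <= t -> `|z i t - zs i| <= rad.
Proof.
move=> t0; have [_ _ h] := lyap_agent_ge i t0; apply: norm_le_sqnorm.
exact: le_trans h (lyap_agent_le i t0).
Qed.

(** A compact region that [x i] never leaves. As it lies in the open set [U i], subgradients are
    bounded on it, and the gap is bounded below away from [xs i]. *)
Let K i := Om i `&` [set w | `|w - xs i| <= rad].
Arguments K : clear implicits.

Lemma K_compact i : compact (K i).
Proof.
apply: (@cV_bounded_closed_compact _ _ _ (rad + `|xs i|)).
  move=> v [_ /= h]; rewrite -[v](subrK (xs i)).
  by apply: le_trans (ler_normD _ _) _; rewrite lerD2r.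
apply: closedI => //.
have -> : [set w | `|w - xs i| <= rad] =
  (fun w => `|w - xs i|) @^-1` [set r : R | r <= rad] by [].
apply: preimage_closed.
  move=> w _ B /nbhs_ballP[e e0 eB]; apply/nbhs_ballP; exists e => // v.
  rewrite -ball_normE /ball_/= => wv; apply: eB; rewrite /ball/=.
  by apply: le_lt_trans (ler_dist_dist _ _) _; rewrite opprB addrA subrK.
exact: closed_le.
Qed.

Lemma x_in_K i t : 0 <= t -> K i (x i t).
Proof. by move=> t0; split; [have [] := x_proj i t0|exact: x_bounded]. Qed.

Lemma K_sub_U i : K i `<=` U i.
Proof. by move=> w [Ow _]; exact: OmU. Qed.

Lemma forcing_bounded i : exists H, forall t g, 0 <= t ->
  subdiff (U i) (f i) (x i t) g -> `|x i t - g + (W i)^T *m lam i t| <= H.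
Proof.
have [C gC] := subdiff_bounded (@U_open i) (@K_sub_U i)
  (strictly_convexW (@f_strict i)) (@K_compact i).
exists (rad + `|xs i| + C + (\sum_j \sum_k `|(W i)^T j k|) * (rad + `|l0|)).
move=> t g t0 gx.
have hx : `|x i t| <= rad + `|xs i|.
  rewrite -[x i t](subrK (xs i)); apply: le_trans (ler_normD _ _) _.
  by rewrite lerD2r x_bounded.
have hl : `|lam i t| <= rad + `|l0|.
  rewrite -[lam i t](subrK l0); apply: le_trans (ler_normD _ _) _.
  by rewrite lerD2r lam_bounded.
apply: le_trans (ler_normD _ _) _; apply: lerD.
  apply: le_trans (ler_normB _ _) _; apply: lerD => //.
  exact: gC _ _ (x_in_K i t0) gx.
apply: le_trans (norm_mulmx_le _ _) _; apply: ler_wpM2l hl.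
by apply: sumr_ge0 => j _; exact: sumr_ge0.
Qed.

Lemma y_coord_derive i : exists H, forall t, 0 < t -> flow t ->
  forall k, exists2 D, is_derive t 1 (fun s => y i s k 0) D &
    `|D + y i t k 0| <= H.
Proof.
have [H hH] := forcing_bounded i; exists H => t t0 ft k.
have [[D yD [g gx DE]] _] := ft i; exists (D k 0); first exact: yD.
apply: le_trans (hH _ _ (ltW t0) gx).
have -> : D k 0 + y i t k 0 = (x i t - g + (W i)^T *m lam i t) k 0.
  by rewrite DE !mxE; ring.
exact: cV_coord_le.
Qed.

Lemma y_coord_bounded i k : exists B, forall t, 0 <= t -> `|y i t k 0| <= B.
Proof.
have [H hH] := y_coord_derive i.
(* The signs [s = 1] and [s = -1] give the upper and the lower bound. *)
have upper (s : R) : `|s| = 1 -> forall t, 0 <= t ->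
    s * y i t k 0 <= H + `|s * y i 0 k 0 - H|.
  move=> s1; apply: (@decay_bound _ (fun t => s * y i t k 0) _ flow) => //.
    move=> T T0; apply: (@abs_cont_dom _ _ (fun (_ : 'I_1) t => y i t k 0) _ _ _ 1).
      by move=> _; exact: y_ac.
    by move=> u v _ _ _; rewrite mul1r big_ord1 -mulrBr normrM s1 mul1r.
  move=> t t0 ft; have [D yD hD] := hH _ t0 ft k; exists (s * D).
    exact: (is_deriveZ s yD).
  suff : s * (D + y i t k 0) <= H by lra.
  by apply: le_trans (ler_norm _) _; rewrite normrM s1 mul1r.
exists ((H + `|1 * y i 0 k 0 - H|) + `|(H + `|-1 * y i 0 k 0 - H|)|
   + `|(H + `|1 * y i 0 k 0 - H|)|).
move=> t t0; have := upper 1 (normr1 _) t t0.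
have := upper (-1) (normrN1 _) t t0.
set b1 := H + `|1 * _ - _|; set b2 := H + _ => h1 h2.
have := ler_norm b2; have := ler_norm b1; have := normr_ge0 b2.
have := normr_ge0 b1; have := ler_norm (- b1); rewrite normrN ler_norml => *.
by apply/andP; split; lra.
Qed.

Lemma y_bounded i : exists B, forall t, 0 <= t -> `|y i t| <= B.
Proof.
have [B yB] := choice (@y_coord_bounded i).
exists (\sum_k `|B k|) => t t0; apply/cV_normP => [|k]; first exact: sumr_ge0.
apply: le_trans (yB k t t0) _; apply: le_trans (ler_norm _) _.
by rewrite (bigD1 k)//= lerDl sumr_ge0.
Qed.

(** The bounds on [y] and on the forcing term bound the derivative of [y]; the projection passes the
    Lipschitz property on to [x]. *)
Lemma x_lipschitz i : exists2 C, 0 < C & forall u v, 0 <= u -> u <= v ->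
  `|x i v - x i u| <= C * (v - u).
Proof.
have [H hH] := y_coord_derive i.
have [B yB] := y_bounded i.
pose M := `|H| + `|B|.
have yl k u v : 0 <= u -> u <= v -> `|y i v k 0 - y i u k 0| <= M * (v - u).
  move=> u0 uv; have [->|uv'] := eqVneq u v; first by rewrite !subrr normr0 mulr0.
  have v0 : 0 < v by apply: le_lt_trans u0 _; rewrite lt_neqAle uv' uv.
  have DM t : 0 < t -> flow t -> exists2 D, is_derive t 1 (fun s => y i s k 0) D & `|D| <= M.
    move=> t0 ft; have [D yD hD] := hH _ t0 ft k; exists D => //.
    rewrite -[D](addrK (y i t k 0)); apply: le_trans (ler_normB _ _) _.
    apply: lerD; first by apply: le_trans hD (ler_norm _).
    apply: le_trans (cV_coord_le _ _) _.
    exact: le_trans (yB t (ltW t0)) (ler_norm _).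
  have yac : abs_cont u v (fun t => y i t k 0).
    exact: abs_cont_sub u0 (lexx v) (y_ac _ _ _).
  have ynac : abs_cont u v (fun t => - y i t k 0).
    apply: (@abs_cont_dom _ _ (fun (_ : 'I_1) t => y i t k 0) _ _ _ 1) => //.
    by move=> r s _ _ _; rewrite mul1r big_ord1 -opprD normrN.
  have h1 : y i v k 0 - y i u k 0 <= M * (v - u).
    apply: (@ae_derive_le _ (fun t => y i t k 0) _ _ _ _ u0 uv yac ae_flow).
    move=> t t0 _ ft; have [D yD hD] := DM _ t0 ft; exists D => //.
    exact: le_trans (ler_norm _) hD.
  have h2 : - y i v k 0 - - y i u k 0 <= M * (v - u).
    apply: (@ae_derive_le _ (fun t => - y i t k 0) _ _ _ _ u0 uv ynac ae_flow).
    move=> t t0 _ ft; have [D yD hD] := DM _ t0 ft; exists (- D).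
      exact: (is_deriveN yD).
    by apply: le_trans (ler_norm _) _; rewrite normrN.
  by rewrite ler_norml; apply/andP; split; lra.
have M0 : 0 <= M by rewrite addr_ge0.
exists ((q i)%:R * M + 1); first by rewrite ltr_wpDl// mulr_ge0.
move=> u v u0 uv; have v0 := le_trans u0 uv.
apply: le_trans (proj_lipschitz (@Om_convex i) (x_proj i u0) (x_proj i v0)) _.
apply: (@le_trans _ _ (\sum_(k < q i) (M * (v - u)))).
  by apply: ler_sum => k _; exact: yl.
rewrite sumr_const card_ord -[(M * _) *+ _]mulr_natl mulrA ler_wpM2r ?subr_ge0//.
by rewrite lerDl.
Qed.

Lemma x_cvg i : x i t @[t --> +oo] --> xs i.
Proof.
apply/cvgrPdist_lt => e e0.
have [C C0 xC] := x_lipschitz i.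
have e20 : 0 < e / 2 by lra.
have [eta eta0 hK] := convex_pos_lower_bound (@U_open i) (@K_sub_U i)
  (@gap_convex i) (@K_compact i)
  (fun w Kw => @gap_gt0 i w (proj1 Kw)) e20.
(* Within time [tau], [x i] moves by at most [e / 2]: starting at distance at least [e] from [xs i],
   it stays at distance at least [e / 2]. *)
pose tau := e / 2 / C.
have tau0 : 0 < tau by rewrite divr_gt0.
pose S := [set lyap t | t in [set t | 0 <= t]].
have infS : has_inf S.
  by split; [exists (lyap 0), 0 => //=|exists 0 => _ [t t0 <-]; exact: lyap_ge0].
(* From [t0] on, [lyap] is within [eta * tau] of its infimum, too little for the drop that a point
   at distance [e] would cause. *)
have [_ [t0 t00 <-] Lt0] := inf_adherent (mulr_gt0 eta0 tau0) infS.
near=> t; rewrite distrC ltNge; apply/negP => xe.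
have t0t : t0 <= t by near: t; apply: nbhs_pinfty_ge; exact: num_real.
have tge0 := le_trans t00 t0t.
have h1 : lyap t <= lyap t0.
  have := @lyap_drop i t0 t 0 t00 t0t; rewrite mul0r addr0; apply => s /andP[t0s _].
  by apply: gap_ge0; have [] := x_proj i (le_trans t00 t0s).
have tt : t <= t + tau by lra.
have h2 : lyap (t + tau) + eta * (t + tau - t) <= lyap t.
  apply: (@lyap_drop i) => // s /andP[ts st]; have s0 := le_trans tge0 ts.
  apply: hK; first exact: x_in_K.
  have := xC _ _ tge0 ts.
  have : C * (s - t) <= e / 2 by rewrite mulrC -ler_pdivlMr//; rewrite -/tau; lra.
  have := ler_distD (x i s) (x i t) (xs i).
  rewrite (distrC (x i t) (x i s)); lra.
have h3 : inf S <= lyap (t + tau).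
  by apply: ge_inf; [case: infS|exists (t + tau) => //=; lra].
move: h2; rewrite addrAC subrr add0r; lra.
Unshelve. all: by end_near. Qed.

Lemma trajectories_bounded : exists M, forall t, 0 <= t -> forall i,
  (forall k, `|y i t k 0| <= M) /\ (forall k, `|x i t k 0| <= M) /\
  (forall k, `|lam i t k 0| <= M) /\ (forall k, `|z i t k 0| <= M).
Proof.
have [B yB] := choice y_bounded.
pose M := \sum_i (`|B i| + `|xs i| + `|l0| + `|zs i|) + `|rad|.
have M_ge i : `|B i| + `|xs i| + `|l0| + `|zs i| + `|rad| <= M.
  rewrite lerD2r (bigD1 i)//= lerDl; apply: sumr_ge0 => j _.
  by rewrite !addr_ge0.
have r0 := ler_norm rad.
exists M => t t0 i; have Mi := M_ge i.
have n0 := normr_ge0 (B i).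
have n1 := normr_ge0 (xs i); have n2 := normr_ge0 l0; have n3 := normr_ge0 (zs i).
have n4 := normr_ge0 rad.
have shift k (u c : 'cV[R]_k) j : `|u - c| <= rad -> `|u j 0| <= rad + `|c|.
  move=> h; apply: le_trans (cV_coord_le _ _) _; rewrite -[u](subrK c).
  by apply: le_trans (ler_normD _ _) _; rewrite lerD2r.
split=> [k|].
  apply: le_trans (cV_coord_le _ _) _; apply: le_trans (yB i t t0) _.
  have := ler_norm (B i).
  lra.
split=> [k|]; first by have := shift _ _ _ k (x_bounded i t0); lra.
split=> k; first by have := shift _ _ _ k (lam_bounded i t0); lra.
by have := shift _ _ _ k (z_bounded i t0); lra.
Qed.

End Dynamics.

(** * Lagrange multiplier of the problem and conclusion *)

(** [multipliers] is applied with the Slater point as base and the coordinates of the coupling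
    residual as constraints. Changing a single component of the optimum then gives one inequality
    per agent. *)
Lemma slater_multiplier (R : realType) (n m : nat) (q : 'I_n -> nat)
  (Om : forall i : 'I_n, set 'cV[R]_(q i)) (f : forall i : 'I_n, 'cV[R]_(q i) -> R)
  (W : forall i : 'I_n, 'M[R]_(m, q i)) (d0 : 'cV[R]_m)
  (xstar : forall i : 'I_n, 'cV[R]_(q i)) :
  (forall i, convex_set (@Om i)) -> (forall i, convex_on (@Om i) (@f i)) ->
  (exists xs : forall i : 'I_n, 'cV[R]_(q i),
      (forall i, interior (@Om i) (xs i)) /\ \sum_i W i *m xs i = d0) ->
  (forall i, @Om i (xstar i)) -> \sum_i W i *m xstar i = d0 ->
  (forall x' : forall i : 'I_n, 'cV[R]_(q i),
      (forall i, @Om i (x' i)) -> \sum_i W i *m x' i = d0 ->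
      \sum_i @f i (xstar i) <= \sum_i @f i (x' i)) ->
  exists l0 : 'cV[R]_m, forall i w, @Om i w -> 0 <= gap f W xstar l0 w.
Proof.
move=> Om_convex f_convex [xs [xs_int xsW]] Om_xstar xstarW xstar_opt.
pose comb (l : R) (u v : forall i : 'I_n, 'cV[R]_(q i)) i := l *: u i + (1 - l) *: v i.
pose r (j : 'I_m) (u : forall i : 'I_n, 'cV[R]_(q i)) := (\sum_i W i *m u i - d0) j 0.
pose C : set (forall i : 'I_n, 'cV[R]_(q i)) := [set u | forall i, @Om i (u i)].
pose F (u : forall i : 'I_n, 'cV[R]_(q i)) := \sum_i @f i (u i) - \sum_i @f i (xstar i).
have xs_core u : C u -> exists2 e, 0 < e & C (comb (- e) u xs).
  move=> Cu.
  have ball i : {b : R | 0 < b & forall h, `|h| <= b -> @Om i (xs i + h)}.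
    apply: cid2; have [b b0 bP] := open_norm_ball (open_interior (@Om i)) (xs_int i).
    by exists b => // h /bP; exact: interior_subset.
  have b0 i : 0 < s2val (ball i) by case: (ball i).
  have bP i h : `|h| <= s2val (ball i) -> @Om i (xs i + h).
    by case: (ball i) => b ? ?; auto.
  pose e i := s2val (ball i) / (`|xs i - u i| + 1).
  have D0 i : 0 < `|xs i - u i| + 1 by rewrite ltr_wpDl.
  (* One step length serves all agents: it keeps each component within a ball around [xs i]
     contained in [Om i]. The 1 covers the case of no agents. *)
  exists (\big[Num.min/1]_i e i).
    by apply: lt_bigmin => // i _; exact: divr_gt0.
  move=> i; set e0 := \big[_/_]_i _.
  have e0i : e0 <= e i by exact: bigmin_le_cond.
  have e0p : 0 <= e0.
    by apply/ltW; apply: lt_bigmin => // j _; exact: divr_gt0.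
  have -> : comb (- e0) u xs i = xs i + e0 *: (xs i - u i).
    by apply/colP => k; rewrite !mxE; ring.
  apply: bP; rewrite normrZ ger0_norm//.
  apply: (@le_trans _ _ (e i * `|xs i - u i|)); first exact: ler_wpM2r.
  rewrite /e -mulrA ler_piMr ?(ltW (b0 i))// mulrC ler_pdivrMr// mul1r.
  by rewrite lerDl.
have [c cP] : exists c : 'I_m -> R, forall u, C u -> \sum_j c j * r j u <= F u.
  apply: (@multipliers _ _ comb _ C F r xs) => //.
  - by move=> i; exact: interior_subset.
  - by move=> u v l Cu Cv l01 i; exact: convex_set_comb (@Om_convex i) (Cu i) (Cv i) l01.
  - move=> u v l Cu Cv l01.
    have : \sum_i @f i (comb l u v i) <=
        l * (\sum_i @f i (u i)) + (1 - l) * (\sum_i @f i (v i)).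
      rewrite !mulr_sumr -big_split; apply: ler_sum => i _.
      exact: (f_convex i _ _ (Cu i) (Cv i) l l01).
    rewrite /F; lra.
  - move=> j l u v; rewrite /r.
    have -> : \sum_i W i *m comb l u v i =
        l *: (\sum_i W i *m u i) + (1 - l) *: (\sum_i W i *m v i).
      rewrite !scaler_sumr -big_split; apply: eq_bigr => i _.
      by rewrite mulmxDr -!scalemxAr.
    by rewrite !mxE; ring.
  - by move=> j; rewrite /r xsW subrr mxE.
  - move=> u Cu ru; rewrite subr_ge0; apply: xstar_opt => //.
    by apply/subr0_eq/colP => j; rewrite [RHS]mxE; exact: ru.
exists (\col_j c j) => i w Ow.
(* The optimum with its [i]-th component replaced by [w], so that the terms of the other agents
   cancel. *)
pose u : forall k, 'cV[R]_(q k) := dfwith xstar i w.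
have ui : u i = w by exact: dfwithin.
have uk k : k != i -> u k = xstar k by move=> ki; apply: dfwithout; rewrite eq_sym.
have Cu : C u.
  by move=> k; have [->|ki] := eqVneq k i; [rewrite ui|rewrite uk].
have := cP u Cu.
have -> : F u = @f i w - @f i (xstar i).
  rewrite /F -sumrB (bigD1 i)//= ui big1 ?addr0// => k ki.
  by rewrite uk// subrr.
have -> : \sum_j c j * r j u = vdot (\col_j c j) (W i *m (w - xstar i)).
  rewrite vdotE; apply: eq_bigr => j _; rewrite mxE; congr (_ * (_ j 0)).
  rewrite -xstarW -sumrB (bigD1 i)//= ui big1 ?addr0 ?mulmxBr// => k ki.
  by rewrite uk// subrr.
rewrite /gap; lra.
Qed.

Unset Implicit Arguments.

Theorem theorem2 (R : realType) (n m : nat) (q : 'I_n -> nat)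
  (* graph *)
  (a : 'I_n -> 'I_n -> R)
  (ha_sym : forall i j, a i j = a j i)
  (ha_nneg : forall i j, 0 <= a i j)
  (ha_loop : forall i, a i i = 0)
  (ha_conn : forall i j, connect (fun i j => 0 < a i j) i j)
  (* local constraint sets *)
  (Om : forall i : 'I_n, set 'cV[R]_(q i))
  (hOm_closed : forall i, closed (Om i))
  (hOm_convex : forall i, convex_set (Om i))
  (* local cost functions, strictly convex on an open convex set U i ⊇ Om i *)
  (f : forall i : 'I_n, 'cV[R]_(q i) -> R)
  (U : forall i : 'I_n, set 'cV[R]_(q i))
  (hU_open : forall i, open (U i))
  (hU_convex : forall i, convex_set (U i))
  (hOmU : forall i, Om i `<=` U i)
  (hf : forall i, strictly_convex_on (U i) (f i))
  (* coupling constraint *)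
  (W : forall i : 'I_n, 'M[R]_(m, q i))
  (d : 'I_n -> 'cV[R]_m) (d0 : 'cV[R]_m)
  (hd0 : \sum_i d i = d0)
  (* Slater's condition *)
  (hslater : exists xs : forall i : 'I_n, 'cV[R]_(q i),
      (forall i, interior (Om i) (xs i)) /\ \sum_i W i *m xs i = d0)
  (* the optimal solution *)
  (xstar : forall i : 'I_n, 'cV[R]_(q i))
  (hxstar_feas : (forall i, Om i (xstar i)) /\ \sum_i W i *m xstar i = d0)
  (hxstar_opt : forall x' : forall i : 'I_n, 'cV[R]_(q i),
      (forall i, Om i (x' i)) -> \sum_i W i *m x' i = d0 ->
      \sum_i f i (xstar i) <= \sum_i f i (x' i))
  (* an arbitrary solution of the algorithm *)
  (y : forall i : 'I_n, R -> 'cV[R]_(q i))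
  (x : forall i : 'I_n, R -> 'cV[R]_(q i))
  (lam z : 'I_n -> R -> 'cV[R]_m)
  (hy_ac : forall i, loc_abs_cont (y i))
  (hlam_ac : forall i, loc_abs_cont (lam i))
  (hz_ac : forall i, loc_abs_cont (z i))
  (hx : forall i t, 0 <= t -> is_proj (Om i) (y i t) (x i t))
  (hdyn : {ae (@lebesgue_measure R), forall t : R, 0 < t ->
     forall i,
       (exists2 Dy : 'cV[R]_(q i), has_deriv (y i) t Dy &
          exists2 g : 'cV[R]_(q i), subdiff (U i) (f i) (x i t) g &
            Dy = - y i t + x i t - g + (W i)^T *m lam i t) /\
       has_deriv (lam i) t
         (d i - W i *m x i t - \sum_j a i j *: (lam i t - lam j t)
              - \sum_j a i j *: (z i t - z j t)) /\
       has_deriv (z i) t (\sum_j a i j *: (lam i t - lam j t))}) :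
  (* (i) boundedness *)
  (exists M : R, forall t : R, 0 <= t -> forall i,
      (forall k, `|y i t k 0| <= M) /\ (forall k, `|x i t k 0| <= M) /\
      (forall k, `|lam i t k 0| <= M) /\ (forall k, `|z i t k 0| <= M)) /\
  (* (ii) convergence of x(t) to the optimal solution *)
  (forall i, x i t @[t --> +oo] --> xstar i).
Proof.
have [Om_xstar xstarW] := hxstar_feas.
have f_convex i : convex_on (Om i) (f i).
  move=> u v Ou Ov; apply: (strictly_convexW (hf i)); exact: hOmU.
have [l0 gap_ge0] := slater_multiplier hOm_convex f_convex hslater Om_xstar
  xstarW hxstar_opt.
(* The right sides sum to [d0 - d0 = 0], the solvability condition for the Laplacian of a connected
   graph. *)
have [zs zsE] : exists zs : 'I_n -> 'cV[R]_m,
    forall i, lap a zs i = d i - W i *m xstar i.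
  by apply: lap_surjective => //; rewrite sumrB hd0 xstarW subrr.
split; first exact: (trajectories_bounded ha_sym ha_nneg hOm_closed hOm_convex
  hU_open hOmU hf Om_xstar gap_ge0 zsE hy_ac hlam_ac hz_ac hx hdyn).
exact: (x_cvg ha_sym ha_nneg hOm_closed hOm_convex
  hU_open hOmU hf Om_xstar gap_ge0 zsE hy_ac hlam_ac hz_ac hx hdyn).
Qed.
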